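(* Let $R$ be a commutative Noetherian local ring, and let $M$ and $N$ be non-zero finitely generated $R$-modules such that $\operatorname{P}_R(M,N)<\infty$. If $\operatorname{qpd}_R M<\infty$, then $$\operatorname{P}_R(M,N)=\operatorname{qpd}_R M=\operatorname{depth} R-\operatorname{depth} M.$$
   Context: For non-zero finitely generated $R$-modules $M,N$, $\operatorname{P}_R(M,N):=\sup\{i\ge 0:\operatorname{Ext}^i_R(M,N)\neq 0\}$. For a complex $X$ of $R$-modules (homologically indexed), $\sup X=\sup\{i: X_i\ne 0\}$, $\inf X=\inf\{i: X_i\neq 0\}$, $\operatorname{hsup}X=\sup\{i: H_i(X)\neq 0\}$. $X$ is bounded below if $\inf X>-\infty$, and bounded if $\sup X-\inf X<\infty$. A quasi-projective resolution of $M$ is a bounded below complex $P$ of (finitely generated) projective $R$-modules such that for all $i\ge\inf P$ there exist non-negative integers $a_i$, not all zero, with $H_i(P)\cong M^{\oplus a_i}$. The quasi-projective dimension of $M\neq 0$ is $\operatorname{qpd}_R M=\inf\{\sup P-\operatorname{hsup}P : P \text{ is a bounded quasi-projective resolution of } M\}$; it is $\infty$ if $M$ has no bounded quasi-projective resolution. *)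

(* Defs.v *)
From HB Require Import structures.
From mathcomp Require Import all_boot all_order all_algebra.
From mathcomp Require Import boolp classical_sets constructive_ereal.
From mathcomp Require Import freeg.

Set Implicit Arguments.
Unset Strict Implicit.
Unset Printing Implicit Defensive.

Import Order.TTheory GRing.Theory Num.Theory.
Import Quotient.Exports.
Local Open Scope ring_scope.
Local Open Scope quotient_scope.
Local Open Scope classical_set_scope.

Section Rings.
Variable R : comNzRingType.

Definition is_ideal (I : set R) : Prop :=
  I 0 /\ forall a x y, I x -> I y -> I (a * x + y).

Definition maximal_ideal (m : set R) : Prop :=
  [/\ is_ideal m, ~ m 1 &
      forall I : set R, is_ideal I -> ~ I 1 -> m `<=` I -> I `<=` m].

Definition noetherian : Prop :=
  forall I : set R, is_ideal I ->
  exists n (g : 'I_n -> R),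
    I = [set x | exists c : 'I_n -> R, x = \sum_(k < n) c k * g k].

Definition local_ring (m : set R) : Prop :=
  maximal_ideal m /\ forall m' : set R, maximal_ideal m' -> m' = m.

End Rings.

Section Modules.
Variable R : comNzRingType.
Implicit Types U V W : lmodType R.

Definition nonzero V : Prop := exists x : V, x != 0.

Definition finitely_generated V : Prop :=
  exists n (g : 'I_n -> V),
    forall x : V, exists c : 'I_n -> R, x = \sum_(k < n) c k *: g k.

Definition projective U : Prop :=
  forall V W (p : {linear V -> W}) (f : {linear U -> W}),
    (forall w, exists v, p v = w) ->
    exists h : {linear U -> V}, forall u, p (h u) = f u.

Definition isomorphic U V : Prop :=
  exists f : {linear U -> V}, bijective f.

End Modules.


(* The homology ker f / (im g `&` ker f) at the middle term of
   A --g--> B --f--> C; it is ker f / im g whenever f \o g = 0. *)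
Section Homology.
Variables (R : comNzRingType) (A B C : lmodType R).
Variables (g : {linear A -> B}) (f : {linear B -> C}).

Definition kernel_pred : {pred B} := [pred x | f x == 0].

Fact kernel_closed : submod_closed kernel_pred.
Proof.
split=> [|a x y]; rewrite !inE ?linear0 // => /eqP fx /eqP fy.
by rewrite linearP fx fy scaler0 addr0.
Qed.
HB.instance Definition _ :=
  GRing.isSubmodClosed.Build R B kernel_pred kernel_closed.

Record kernel : Type :=
  Kernel { kernel_val :> B; _ : kernel_val \in kernel_pred }.
HB.instance Definition _ := [isSub for kernel_val].
HB.instance Definition _ := [Choice of kernel by <:].
HB.instance Definition _ := [SubChoice_isSubLmodule of kernel by <:].

Definition boundary : {pred kernel} :=
  [pred z : kernel | `[< exists x, g x = kernel_val z >]].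

Fact boundary_closed : submod_closed boundary.
Proof.
split=> [|a x y]; first by apply/asboolP; exists (0 : A); rewrite linear0.
move=> /asboolP[u gu] /asboolP[v gv]; apply/asboolP.
by exists (a *: u + v); rewrite linearP gu gv.
Qed.
HB.instance Definition _ :=
  GRing.isSubmodClosed.Build R kernel boundary boundary_closed.

Definition homology : Type := @Quotient.quot kernel boundary.
HB.instance Definition _ := GRing.Zmodule.on homology.
HB.instance Definition _ := Quotient.on homology.

Definition homology_class (z : kernel) : homology := \pi_(homology) z.
Definition homology_scale (a : R) (x : homology) : homology :=
  homology_class (a *: repr x).

Lemma homology_classK x : homology_class (repr x) = x.
Proof. exact: reprK. Qed.

Lemma homology_class_eq (x y : kernel) :
  (homology_class x == homology_class y) = (x - y \in boundary).
Proof. by rewrite (Quotient.idealrBE boundary). Qed.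

Lemma homology_classD : {morph homology_class : x y / x + y}.
Proof. exact: (@Quotient.pi_add _ boundary). Qed.

Lemma homology_classZ a x :
  homology_class (a *: x) = homology_scale a (homology_class x).
Proof.
apply/eqP; rewrite homology_class_eq -scalerBr rpredZ//.
by rewrite -homology_class_eq homology_classK.
Qed.

Lemma homology_ind (P : homology -> Prop) :
  (forall z, P (homology_class z)) -> forall x, P x.
Proof. by move=> h x; rewrite -[x]reprK; apply: h. Qed.

Fact homology_scaleA a b x :
  homology_scale a (homology_scale b x) = homology_scale (a * b) x.
Proof.
by elim/homology_ind: x => x; rewrite -!homology_classZ scalerA.
Qed.

Fact homology_scale1 : left_id 1 homology_scale.
Proof. by elim/homology_ind => x; rewrite -homology_classZ scale1r. Qed.

Fact homology_scaleDr : right_distributive homology_scale +%R.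
Proof.
move=> a; elim/homology_ind => x; elim/homology_ind => y.
by rewrite -homology_classD -!homology_classZ scalerDr homology_classD.
Qed.

Fact homology_scaleDl x : {morph homology_scale^~ x : a b / a + b}.
Proof.
move=> a b; elim/homology_ind: x => x.
by rewrite -!homology_classZ scalerDl homology_classD.
Qed.

HB.instance Definition _ := GRing.Zmodule_isLmodule.Build R homology
  homology_scaleA homology_scale1 homology_scaleDr homology_scaleDl.

Fact homology_class_linear : linear homology_class.
Proof. by move=> a x y; rewrite homology_classD homology_classZ. Qed.
HB.instance Definition _ := GRing.isLinear.Build R kernel homology *:%R
  homology_class homology_class_linear.

Lemma homology_class_eq0 (z : kernel) :
  (homology_class z == 0) <-> exists x, g x = kernel_val z.
Proof.
rewrite -(raddf0 homology_class) homology_class_eq subr0.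
by split=> [/asboolP|?] //; apply/asboolP.
Qed.

End Homology.

Section Hom.
Variables (R : comNzRingType) (U V : lmodType R).

Definition Hom : Type := {linear U -> V}.
HB.instance Definition _ := gen_eqMixin Hom.
HB.instance Definition _ := gen_choiceMixin Hom.

Definition hom_fun (f : Hom) : {linear U -> V} := f.

Lemma hom_ext (f g : Hom) : hom_fun f =1 hom_fun g -> f = g.
Proof.
rewrite /hom_fun; case: f g => [f [[p] [q]]] [g [[p'] [q']]] /= /funext fg.
rewrite fg in p q p' q' *.
by rewrite (Prop_irrelevance p p') (Prop_irrelevance q q').
Qed.

Definition hom_zero : Hom := \0.
Definition hom_opp (f : Hom) : Hom := \- hom_fun f.
Definition hom_add (f g : Hom) : Hom := hom_fun f \+ hom_fun g.
Definition hom_scale (a : R) (f : Hom) : Hom := a \*: hom_fun f.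

Fact hom_addA : associative hom_add.
Proof. by move=> f g h; apply: hom_ext => x /=; rewrite addrA. Qed.
Fact hom_addC : commutative hom_add.
Proof. by move=> f g; apply: hom_ext => x /=; rewrite addrC. Qed.
Fact hom_add0 : left_id hom_zero hom_add.
Proof. by move=> f; apply: hom_ext => x /=; rewrite add0r. Qed.
Fact hom_addN : left_inverse hom_zero hom_opp hom_add.
Proof. by move=> f; apply: hom_ext => x /=; rewrite addNr. Qed.
HB.instance Definition _ :=
  GRing.isZmodule.Build Hom hom_addA hom_addC hom_add0 hom_addN.

Fact hom_scaleA a b f : hom_scale a (hom_scale b f) = hom_scale (a * b) f.
Proof. by apply: hom_ext => x /=; rewrite scalerA. Qed.
Fact hom_scale1 : left_id 1 hom_scale.
Proof. by move=> f; apply: hom_ext => x /=; rewrite scale1r. Qed.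
Fact hom_scaleDr : right_distributive hom_scale +%R.
Proof. by move=> a f g; apply: hom_ext => x /=; rewrite scalerDr. Qed.
Fact hom_scaleDl f : {morph hom_scale^~ f : a b / a + b}.
Proof. by move=> a b; apply: hom_ext => x /=; rewrite scalerDl. Qed.
HB.instance Definition _ := GRing.Zmodule_isLmodule.Build R Hom
  hom_scaleA hom_scale1 hom_scaleDr hom_scaleDl.

End Hom.

Section Precomposition.
Variables (R : comNzRingType) (U U' V : lmodType R) (d : {linear U -> U'}).

Definition precomp (f : Hom U' V) : Hom U V := hom_fun f \o d.

Fact precomp_linear : linear precomp.
Proof. by move=> a f g; apply: hom_ext. Qed.
HB.instance Definition _ :=
  GRing.isLinear.Build R (Hom U' V) (Hom U V) *:%R precomp precomp_linear.

End Precomposition.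

(* Homologically indexed complexes; the differential is given between any two
   degrees and vanishes unless it lowers the degree by one, which avoids
   transporting along equalities such as i + 1 - 1 = i. *)
Record complex (R : comNzRingType) : Type := Complex {
  cx_obj :> int -> lmodType R;
  cx_diff : forall i j : int, {linear cx_obj i -> cx_obj j};
  cx_diff_shape : forall i j, i != j + 1 -> forall x, cx_diff i j x = 0;
  cx_diff_diff : forall i j k x, cx_diff j k (cx_diff i j x) = 0
}.

Section Complexes.
Variable R : comNzRingType.
Implicit Types (X P : complex R) (M N : lmodType R).

Definition Hlgy X (i : int) : lmodType R :=
  homology (cx_diff X (i + 1) i) (cx_diff X i (i - 1)).

(* The cohomology of Hom(X, N) in cohomological degree i. *)
Definition Hlgy_Hom X N (i : int) : lmodType R :=
  homology (@precomp _ _ _ N (cx_diff X i (i - 1)))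
           (@precomp _ _ _ N (cx_diff X (i + 1) i)).

Definition projective_resolution M P : Prop :=
  [/\ forall i, projective (P i),
      forall i, i < 0 -> ~ nonzero (P i),
      forall i, i != 0 -> ~ nonzero (Hlgy P i) &
      isomorphic (Hlgy P 0) M].

End Complexes.

(* Every module has a projective resolution: iterate the surjection onto a
   module from the free module on its underlying set. *)
Section ProjectiveResolution.
Variable R : comNzRingType.
Implicit Types V W : lmodType R.

Definition free_on V : lmodType R := {freeg V / R}.
Definition free_lift V W (f : V -> W) : free_on V -> W := fglift f.

Fact free_lift_linear V W (f : V -> W) : linear (free_lift f).
Proof.
have addf : zmod_morphism (free_lift f) by exact: lift_is_additive.
pose fA : {additive free_on V -> W} :=
  HB.pack (free_lift f) (GRing.isZmodMorphism.Build _ _ (free_lift f) addf).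
have fU k x : fA << k *g x >> = k *: f x by exact: liftU.
move=> a x y; change (fA (a *: x + y) = a *: fA x + fA y).
rewrite raddfD; congr (_ + _).
rewrite -[x]freeg_sumE scaler_sumr !(raddf_sum fA) scaler_sumr.
apply: eq_bigr => v _; rewrite fU scalerA -fU; congr (fA _).
by apply/eqP/freeg_eqP => z; rewrite coeffZ !coeffU mulrA.
Qed.
HB.instance Definition _ V W (f : V -> W) :=
  GRing.isLinear.Build R (free_on V) W *:%R (free_lift f) (free_lift_linear f).

Lemma free_liftU V W (f : V -> W) v : free_lift f << v >> = f v.
Proof. by rewrite /free_lift liftU scale1r. Qed.

Lemma free_on_eq V W (f g : {linear free_on V -> W}) :
  (forall v, f << v >> = g << v >>) -> f =1 g.
Proof.
have sU c v : << c *g v >> = c *: (<< v >> : free_on V) :> free_on V.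
  by apply/eqP/freeg_eqP => z; rewrite coeffZ !coeffU mul1r.
have hU (h : {linear free_on V -> W}) c v : h << c *g v >> = c *: h << v >>.
  by rewrite sU linearZ.
move=> fg x; rewrite -[x]freeg_sumE (raddf_sum f) (raddf_sum g).
apply: eq_bigr => v _; apply: (etrans (hU f _ _)).
by rewrite fg; apply/esym/(hU g).
Qed.

Lemma free_on_projective V : projective (free_on V).
Proof.
move=> A B p f surjp.
pose s v := sval (cid (surjp (f << v >>))).
exists (free_lift s).
apply: (@free_on_eq _ _ (p \o free_lift s) f) => v /=.
by rewrite free_liftU /s; case: cid.
Qed.

Lemma zero_projective V : ~ nonzero V -> projective V.
Proof.
move=> V0 A B p f _; exists \0 => u /=.
have -> : u = 0 by apply: contrapT => /eqP u0; apply: V0; exists u.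
by rewrite !linear0.
Qed.

Definition cover V : {linear free_on V -> V} := free_lift id.

Fixpoint syzygy V (n : nat) : lmodType R :=
  if n is m.+1 then kernel (cover (syzygy V m)) else V.

Definition res_diff V n :
    {linear free_on (syzygy V n.+1) -> free_on (syzygy V n)} :=
  val \o cover (syzygy V n.+1).

Definition res_obj V (i : int) : lmodType R :=
  if i is Posz n then free_on (syzygy V n) else 'rV[R]_0.

Definition res_map V (i j : int) : {linear res_obj V i -> res_obj V j} :=
  match i, j with
  | Posz m, Posz n =>
    match m =P n.+1 with
    | ReflectT e => ecast k ({linear res_obj V (Posz k) -> free_on (syzygy V n)})
                      (esym e) (res_diff V n)
    | _ => \0
    end
  | _, _ => \0
  end.

Lemma res_mapS V n : res_map V (Posz n.+1) (Posz n) = res_diff V n.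
Proof. by rewrite /res_map; case: eqP => // e; rewrite (eq_axiomK (esym e)). Qed.

Lemma res_map_shape V i j : i != j + 1 -> forall x, res_map V i j x = 0.
Proof.
case: i j => [m|m] [n|n] //= neq x; case: eqP => //= e.
by case/eqP: neq; rewrite -PoszD addn1; exact: (f_equal Posz e).
Qed.

Lemma res_diff_eq0 V n z :
  res_diff V n z = 0 -> exists y, res_diff V n.+1 y = z.
Proof.
move=> dz; have zK : z \in kernel_pred (cover (syzygy V n.+1)).
  by rewrite inE; apply/eqP/val_inj; rewrite raddf0.
by exists << (Kernel zK : syzygy V n.+2) >> => /=; rewrite free_liftU.
Qed.

Lemma res_diff_diff V n y : res_diff V n (res_diff V n.+1 y) = 0.
Proof.
rewrite /=; case: (cover _ y) => z /= zK.
by move: zK; rewrite inE => /eqP ->.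
Qed.

Lemma res_map_map V i j k x : res_map V j k (res_map V i j x) = 0.
Proof.
have [ij|/res_map_shape-> ] := eqVneq i (j + 1); last by rewrite linear0.
have [jk|/res_map_shape-> //] := eqVneq j (k + 1).
case: k jk => [n|n] jk; last by case: j jk {ij x} (res_map V i j x).
have ej : j = n.+1 by rewrite jk -PoszD addn1.
have ei : i = n.+2 by rewrite ij ej -PoszD addn1.
by rewrite ei ej in x *; rewrite !res_mapS res_diff_diff.
Qed.

Definition free_resolution V : complex R :=
  Complex (@res_map_shape V) (@res_map_map V).

Lemma res_map_exact V i j k : i = j + 1 -> k = j - 1 -> j != 0 ->
  forall z, res_map V j k z = 0 -> exists y, res_map V i j y = z.
Proof.
case: j => [[|n]|n] // ij kj _ z.
  have ek : k = n by rewrite kj subzn ?subn1.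
  have ei : i = n.+2 by rewrite ij -PoszD addn1.
  by rewrite ei ek !res_mapS; apply: res_diff_eq0.
by move=> _; exists 0; rewrite linear0; apply/esym/matrixP => ? [].
Qed.

Lemma homology_eq0 (A B C : lmodType R) (g : {linear A -> B})
    (f : {linear B -> C}) :
  (forall z, f z = 0 -> exists y, g y = z) -> ~ nonzero (homology g f).
Proof.
move=> exact_gf [x]; elim/homology_ind: x => -[z zK] /negP; apply.
by apply/homology_class_eq0/exact_gf/eqP.
Qed.

Lemma homology_iso (A B C W : lmodType R) (g : {linear A -> B})
    (f : {linear B -> C}) (p : {linear B -> W}) :
  (forall z, f z = 0) -> (forall w, exists z, p z = w) ->
  (forall z, p z = 0 <-> exists y, g y = z) ->
  isomorphic (homology g f) W.
Proof.
move=> f0 surjp kerp.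
pose q (x : homology g f) := p (kernel_val (repr x)).
have qE z : q (homology_class g z) = p (kernel_val z).
  apply/eqP; rewrite -subr_eq0 -raddfB -(raddfB val); apply/eqP/kerp.
  apply/homology_class_eq0; rewrite raddfB subr_eq0.
  exact/eqP/homology_classK.
have q_lin : linear q.
  move=> a; elim/homology_ind => x; elim/homology_ind => y.
  by rewrite -linearP !qE linearP.
pose qL : {linear homology g f -> W} :=
  HB.pack q (GRing.isLinear.Build _ _ _ _ q q_lin).
have zK z : z \in kernel_pred f by rewrite inE f0.
pose s w := homology_class g (Kernel (zK (sval (cid (surjp w))))).
have qs : cancel s q by move=> w; rewrite /s qE /=; case: cid.
exists qL; exists s => //= x; apply/eqP; rewrite -subr_eq0.
have : qL (s (q x) - x) = 0.
  by rewrite raddfB; change (q (s (q x)) - q x = 0); rewrite qs subrr.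
elim/homology_ind: (_ - _) => z; rewrite /= qE => /kerp.
by move/homology_class_eq0.
Qed.

Lemma free_resolutionP V : projective_resolution V (free_resolution V).
Proof.
split.
- case=> n /=; first exact: free_on_projective.
  by apply: zero_projective => -[x /eqP]; apply; apply/matrixP => ? [].
- by case=> n // _ [x /eqP]; apply; apply/matrixP => ? [].
- by move=> i i0; apply: homology_eq0; apply: res_map_exact.
- apply: (@homology_iso _ _ _ _ _ _ (cover V)) => [z|w|z].
  + by [].
  + by exists << w >>; rewrite /= free_liftU.
  + rewrite [cx_diff _ _ _](res_mapS V 0) /=.
    split=> [z0|[y <-]]; last by case: (cover (syzygy V 1) y) => ? /= /eqP.
    have zK : z \in kernel_pred (cover V) by rewrite inE; apply/eqP.
    by exists << (Kernel zK : syzygy V 1) >>; rewrite free_liftU.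
Qed.

End ProjectiveResolution.

(* Suprema and infima are taken in the extended integers, so that
   sup set0 = -oo and inf set0 = +oo. *)
Section Invariants.
Variable R : comNzRingType.
Implicit Types (X P : complex R) (M N : lmodType R).
Local Open Scope ereal_scope.

Definition eint_sup (A : set (\bar int)) : \bar int := supremum -oo A.
Definition eint_inf (A : set (\bar int)) : \bar int := infimum +oo A.

(* Ext^i(M, N) is computed from the projective resolution of M by free modules
   provided by free_resolutionP. *)
Definition Ext (i : nat) M N : lmodType R :=
  Hlgy_Hom (free_resolution M) N i.

Definition PExt M N : \bar int :=
  eint_sup [set i%:Z%:E | i in [set i : nat | nonzero (Ext i M N)]].

Definition csup X : \bar int :=
  eint_sup [set i%:E | i in [set i : int | nonzero (X i)]].
Definition cinf X : \bar int :=
  eint_inf [set i%:E | i in [set i : int | nonzero (X i)]].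
Definition hsup X : \bar int :=
  eint_sup [set i%:E | i in [set i : int | nonzero (Hlgy X i)]].

Definition bounded_below X : Prop := -oo < cinf X.
Definition bounded X : Prop := csup X - cinf X < +oo.

Definition quasi_projective_resolution M P : Prop :=
  [/\ bounded_below P,
      forall i, finitely_generated (P i) /\ projective (P i) &
      exists a : int -> nat,
        (exists i : int, cinf P <= i%:E /\ a i <> 0%N) /\
        forall i : int, cinf P <= i%:E ->
          isomorphic (Hlgy P i) {ffun 'I_(a i) -> M}].

Definition qpd M : \bar int :=
  eint_inf [set d | exists P,
    [/\ quasi_projective_resolution M P, bounded P & d = csup P - hsup P]].

(* x \in (s_0, ..., s_(n-1)) M *)
Definition in_seq_submodule (s : seq R) M (x : M) : Prop :=
  exists y : nat -> M, x = (\sum_(k < size s) s`_k *: y k)%R.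

(* s_i is a nonzerodivisor on M / (s_0, ..., s_(i-1)) M for each i, and
   M / (s) M is nonzero. *)
Definition regular_sequence (s : seq R) M : Prop :=
  (forall i, (i < size s)%N -> forall x : M,
     in_seq_submodule (take i s) (s`_i *: x)%R ->
     in_seq_submodule (take i s) x) /\
  exists x : M, ~ in_seq_submodule s x.

Definition depth (m : set R) M : \bar int :=
  eint_sup [set (size s)%:Z%:E | s in
    [set s : seq R | (forall x, x \in s -> m x) /\ regular_sequence s M]].

End Invariants.

(* Main.v *)
Require Import Defs.
From HB Require Import structures.
From mathcomp Require Import all_boot all_order all_algebra.
From mathcomp Require Import boolp classical_sets constructive_ereal zify.

(* Choose a bounded quasi-projective resolution P of M for which
   n = sup P - hsup P is minimal and, then, P_(sup P) has as few generators as
   possible. A vector u of P_(sup P) and a form g with g(d u) a unit would split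
   off a contractible summand, so d maps P_(sup P) into m P_(sup P - 1); by
   construction qpd M = n.

   Dimension shifting along the cokernels C_i and images B_i of the differentials
   of P, with 0 -> M^a_i -> C_i -> B_(i-1) -> 0 and 0 -> B_i -> P_i -> C_i -> 0,
   shows that Ext^j(M, N) = 0 for j > n, as soon as it vanishes for large j. If
   the last nonzero Ext were below n, then Hom(P_(sup P - 1), N) would map onto
   Hom(P_(sup P), N), which Nakayama's lemma forbids because d is zero modulo m.

   For the depths, let s be a maximal sequence in m that is regular on both R and
   M; then H(P/sP) = H(P)/sH(P), and R/s or M/sM has a socle. In the first case
   the socle of R/s produces cycles of P/sP in degree sup P, so that M/sM has a
   socle in both cases. Prolong s by an R-regular sequence
   y_1, ..., y_l until R/(s, y) has a socle: each y_j raises by one the top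
   homological degree and keeps a socle there, and in the end this degree is
   sup P. Therefore n = l = depth R - depth M. *)

Set Implicit Arguments.
Unset Strict Implicit.
Unset Printing Implicit Defensive.

Import Order.TTheory GRing.Theory Num.Theory.
Local Open Scope ring_scope.
Local Open Scope classical_set_scope.

(** * Submodules of finitely generated modules *)

Inductive zexpr := ZZero | ZVar of nat | ZAdd of zexpr & zexpr | ZOpp of zexpr.

Fixpoint zeval (V : zmodType) (env : seq V) (e : zexpr) : V :=
  match e with
  | ZZero => 0
  | ZVar n => nth 0 env n
  | ZAdd e1 e2 => zeval env e1 + zeval env e2
  | ZOpp e1 => - zeval env e1
  end.

Fixpoint zcoef (e : zexpr) (k : nat) : int :=
  match e with
  | ZZero => 0
  | ZVar n => (n == k)%:Z
  | ZAdd e1 e2 => zcoef e1 k + zcoef e2 k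
  | ZOpp e1 => - zcoef e1 k
  end.

Lemma zeval_coef (V : zmodType) (env : seq V) e :
  zeval env e = \sum_(k < size env) env`_k *~ zcoef e k.
Proof.
elim: e => [|n|e1 IH1 e2 IH2|e1 IH1] /=.
- by rewrite big1.
- have [lt_n|ge_n] := ltnP n (size env).
    rewrite (bigD1 (Ordinal lt_n)) //= eqxx mulr1z big1 ?addr0 // => k.
    by rewrite -val_eqE eq_sym => /negPf /= ->; rewrite mulr0z.
  rewrite nth_default // big1 // => k _.
  by rewrite eqn_leq [(n <= k)%N]leqNgt (leq_trans (ltn_ord k)) ?mulr0z.
- by rewrite IH1 IH2 -big_split; apply: eq_bigr => k _; rewrite mulrzDr.
- by rewrite IH1 -sumrN; apply: eq_bigr => k _; rewrite mulrNz.
Qed.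

Lemma zeval_eq (V : zmodType) (env : seq V) e1 e2 :
  all (fun k => zcoef e1 k == zcoef e2 k) (iota 0 (size env)) ->
  zeval env e1 = zeval env e2.
Proof.
move/allP=> eq12; rewrite !zeval_coef; apply: eq_bigr => k _.
by rewrite (eqP (eq12 k _)) // mem_iota ltn_ord.
Qed.

Ltac zmod_add x env :=
  match env with
  | @nil ?T => constr:(@cons T x (@nil T))
  | @cons ?T ?y ?env' =>
    let _ := match goal with _ => unify x y end in constr:(env)
  | @cons ?T ?y ?env' => let e := zmod_add x env' in constr:(@cons T y e)
  end.
Ltac zmod_atoms t env :=
  lazymatch t with
  | (?a + ?b)%R => let env1 := zmod_atoms a env in zmod_atoms b env1
  | (- ?a)%R => zmod_atoms a env
  | 0%R => env
  | ?x => zmod_add x env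
  end.
Ltac zmod_index x env :=
  match env with
  | @cons _ ?y _ =>
    let _ := match goal with _ => unify x y end in constr:(O)
  | @cons _ _ ?env' => let n := zmod_index x env' in constr:(S n)
  end.
Ltac zmod_reify t env :=
  lazymatch t with
  | (?a + ?b)%R => let e1 := zmod_reify a env in
      let e2 := zmod_reify b env in constr:(ZAdd e1 e2)
  | (- ?a)%R => let e := zmod_reify a env in constr:(ZOpp e)
  | 0%R => constr:(ZZero)
  | ?x => let n := zmod_index x env in constr:(ZVar n)
  end.

(* Decides equations valid in every abelian group, after expanding scalar
   multiplication. *)
Ltac zmod_solve :=
  rewrite ?(scalerDr, scalerDl, scalerN, scaleNr, scale0r, scaler0, scalerA);
  lazymatch goal with |- @eq ?T ?a ?b =>
    let env0 := zmod_atoms a (@nil T) in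
    let env := zmod_atoms b env0 in
    let e1 := zmod_reify a env in
    let e2 := zmod_reify b env in
    apply: (@zeval_eq _ env e1 e2); vm_compute; reflexivity
  end.

Section Submodules.
Variable R : comNzRingType.
Implicit Types (V W : lmodType R).

Definition submodule V (U : set V) : Prop :=
  U 0 /\ forall a x y, U x -> U y -> U (a *: x + y).

Lemma submodule0 V (U : set V) : submodule U -> U 0.
Proof. by case. Qed.

Lemma submoduleD V (U : set V) x y : submodule U -> U x -> U y -> U (x + y).
Proof. by case=> _ UL /(UL 1 x y) + Uy => /(_ Uy); rewrite scale1r. Qed.

Lemma submoduleZ V (U : set V) a x : submodule U -> U x -> U (a *: x).
Proof. by case=> U0 UL /(UL a x 0) /(_ U0); rewrite addr0. Qed.

Lemma submoduleN V (U : set V) x : submodule U -> U x -> U (- x).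
Proof. by move=> sU Ux; rewrite -scaleN1r; exact: submoduleZ. Qed.

Lemma submoduleB V (U : set V) x y : submodule U -> U x -> U y -> U (x - y).
Proof. by move=> sU Ux Uy; apply: submoduleD => //; exact: submoduleN. Qed.

Lemma submoduleBl V (U : set V) x y :
  submodule U -> U y -> U (x - y) -> U x.
Proof. by move=> sU Uy Uxy; rewrite -(subrK y x); exact: submoduleD. Qed.

Lemma submodule_setT V : submodule (@setT V).
Proof. by []. Qed.

Lemma submodule_eq0 V : submodule [set (0 : V)].
Proof. by split=> // a x y /= -> ->; rewrite scaler0 addr0. Qed.

Lemma submoduleI V (U U' : set V) :
  submodule U -> submodule U' -> submodule (U `&` U').
Proof.
move=> sU sU'; split=> [|a x y [Ux U'x] [Uy U'y]].
  by split; exact: submodule0.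
by split; apply: submoduleD => //; exact: submoduleZ.
Qed.

Lemma submoduleX V W (U : set V) (U' : set W) :
  submodule U -> submodule U' -> submodule (U `*` U').
Proof.
move=> sU sU'; split=> [|a x y [Ux U'x] [Uy U'y]].
  by split; exact: submodule0.
by split; apply: submoduleD => //; exact: submoduleZ.
Qed.

Fixpoint lspan V (l : seq V) : set V :=
  if l is g :: l' then [set x | exists a : R, lspan l' (x - a *: g)]
  else [set 0].

Lemma lspan_submodule V (l : seq V) : submodule (lspan l).
Proof.
elim: l => [|g l IHl]; first exact: submodule_eq0.
split=> [|a x y [b xb] [c yc]].
  by exists 0; rewrite scale0r subr0; exact: submodule0.
exists (a * b + c); rewrite scalerDl -scalerA opprD addrACA -scalerBr.
by apply: submoduleD => //; exact: submoduleZ.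
Qed.

Lemma mem_lspan V (l : seq V) x : x \in l -> lspan l x.
Proof.
elim: l => //= g l IHl; rewrite inE => /predU1P[->|/IHl xl].
  by exists 1; rewrite scale1r subrr; exact: submodule0 (lspan_submodule _).
by exists 0; rewrite scale0r subr0.
Qed.

Lemma lspan_sub V (l : seq V) (U : set V) :
  submodule U -> (forall x, x \in l -> U x) -> lspan l `<=` U.
Proof.
move=> sU; elim: l => [|g l IHl] lU x /=; first by move=> ->; exact: submodule0.
case=> a /IHl xU; apply: (@submoduleBl _ _ _ (a *: g)) => //.
  by apply: submoduleZ => //; apply: lU; rewrite mem_head.
by apply: xU => y yl; apply: lU; rewrite inE yl orbT.
Qed.

Lemma lspan_sum V n (g : 'I_n -> V) x :
  lspan (codom g) x <-> exists c : 'I_n -> R, x = \sum_(k < n) c k *: g k.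
Proof.
split; last first.
  case=> c ->; elim/big_ind: _ => [|y z|k _].
  - exact: submodule0 (lspan_submodule _).
  - exact: submoduleD (lspan_submodule _).
  - by apply: (submoduleZ _ (lspan_submodule _)); apply/mem_lspan/codom_f.
apply: (@lspan_sub _ _ [set x | exists c : 'I_n -> R, x = \sum_(k < n) c k *: g k]).
  split=> [|a y z [c ->] [d ->]].
    by exists (fun=> 0); rewrite big1 // => k _; rewrite scale0r.
  exists (fun k => a * c k + d k); rewrite scaler_sumr -big_split /=.
  by apply: eq_bigr => k _; rewrite scalerDl scalerA.
move=> _ /codomP[k ->]; exists (fun j => (j == k)%:R).
rewrite (bigD1 k) //= eqxx scale1r big1 ?addr0 // => j /negPf ->.
by rewrite scale0r.
Qed.

Lemma finitely_generatedE V :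
  finitely_generated V <-> exists l : seq V, forall x, lspan l x.
Proof.
split=> [[n [g gV]]|[l lV]].
  by exists (codom g) => x; exact/lspan_sum.
exists (size l), (tnth (in_tuple l)) => x; apply/lspan_sum.
have -> // : codom (tnth (in_tuple l)) = l.
by rewrite codomE map_tnth_enum.
Qed.

Fixpoint genby (s : seq R) V (A : set V) : set V :=
  if s is x :: s' then [set v | exists2 w, A w & genby s' A (v - x *: w)]
  else [set 0].

Lemma genby_submodule s V (A : set V) : submodule A -> submodule (genby s A).
Proof.
move=> sA; elim: s => [|x s IHs]; first exact: submodule_eq0.
split=> [|a y z [v Av yv] [w Aw zw]].
  by exists 0; rewrite ?scaler0 ?subr0; exact: submodule0.
exists (a *: v + w); first by apply: submoduleD => //; exact: submoduleZ.
rewrite scalerDr scalerA [x * a]mulrC -scalerA opprD addrACA -scalerBr.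
by apply: submoduleD => //; exact: submoduleZ.
Qed.

Lemma sub_genby x s V (A : set V) : submodule A -> genby s A `<=` genby (x :: s) A.
Proof.
by move=> sA v sv; exists 0; rewrite ?scaler0 ?subr0 //; exact: submodule0.
Qed.

Lemma genby_head x s V (A : set V) v :
  submodule A -> A v -> genby (x :: s) A (x *: v).
Proof.
move=> sA Av; exists v => //; rewrite subrr.
exact: submodule0 (genby_submodule _ _).
Qed.

Lemma genby_mem x s V (A : set V) v :
  submodule A -> A v -> x \in s -> genby s A (x *: v).
Proof.
move=> sA Av; elim: s => //= y s IHs; rewrite inE => /predU1P[->|/IHs].
  exact: genby_head.
exact: sub_genby.
Qed.

Lemma genby_min s V (A U : set V) : submodule U ->
  (forall x v, x \in s -> A v -> U (x *: v)) -> genby s A `<=` U.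
Proof.
move=> sU; elim: s => [|x s IHs] AU v; first by move=> ->; exact: submodule0.
case=> w Aw /IHs wU; apply: (@submoduleBl _ _ _ (x *: w)) => //.
  by apply: AU; rewrite ?mem_head.
by apply: wU => y u ys Au; apply: AU; rewrite // inE ys orbT.
Qed.

Lemma genby_subset s t V (A : set V) : submodule A ->
  {subset s <= t} -> genby s A `<=` genby t A.
Proof.
move=> sA st; apply: genby_min; first exact: genby_submodule.
by move=> x v /st xt Av; exact: genby_mem.
Qed.

Lemma eq_genby s t V (A : set V) : submodule A -> s =i t -> genby s A = genby t A.
Proof.
by move=> sA st; apply/seteqP; split; apply: genby_subset => // x; rewrite st.
Qed.

Lemma genby_map s V W (A : set V) (B : set W) (f : {linear V -> W}) :
  (forall v, A v -> B (f v)) -> forall v, genby s A v -> genby s B (f v).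
Proof.
move=> fAB; elim: s => [|x s IHs] v /=; first by move=> ->; exact: linear0.
case=> w Aw sw; exists (f w); first exact: fAB.
by rewrite -linearZ -linearB; exact: IHs.
Qed.

Lemma genby_lift s V W (A : set V) (B : set W) (f : {linear V -> W}) :
  (forall w, B w -> exists2 v, A v & f v = w) ->
  forall w, genby s B w -> exists2 v, genby s A v & f v = w.
Proof.
move=> fAB; elim: s => [|x s IHs] w.
  by move=> -> /=; exists 0; rewrite ?linear0.
case=> _ /fAB[v Av <-] /IHs[u Au fu]; exists (u + x *: v).
  by exists v => //; rewrite addrK.
by rewrite linearD linearZ /= fu subrK.
Qed.

Lemma in_seq_submoduleE s V (v : V) : in_seq_submodule s v <-> genby s setT v.
Proof.
elim: s v => [|x s IHs] v.
  by split=> [[y ->]|->]; [|exists (fun=> 0)]; rewrite big_ord0.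
split=> [[y ->]|[w _ /IHs[y yv]]].
  exists (y 0%N) => //; apply/IHs; exists (y \o succn).
  by rewrite big_ord_recl /= addrC addKr.
exists (fun k => if k is k'.+1 then y k' else w).
by rewrite big_ord_recl /= -yv addrC subrK.
Qed.

End Submodules.

Section Noetherian.
Variable R : comNzRingType.
Hypothesis noethR : noetherian R.
Implicit Types (V W : lmodType R).

Lemma ideal_lspan (I : set R) : is_ideal I ->
  exists l : seq R^o, I = lspan l.
Proof.
move=> /noethR[n [g ->]]; exists (codom (g : 'I_n -> R^o)).
apply/seteqP; split=> x; case: (@lspan_sum _ R^o n g x) => h1 h2; first exact: h2.
exact: h1.
Qed.

Lemma submodule_lspan V (l : seq V) (U : set V) :
  submodule U -> U `<=` lspan l -> exists l', U = lspan l'.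
Proof.
elim: l U => [|g l IHl] U sU Ul.
  exists [::]; apply/seteqP; split=> // x ->; exact: submodule0.
have sl := lspan_submodule l.
pose I : set R := [set a | exists2 u, U u & lspan l (u - a *: g)].
have /ideal_lspan[L IL] : is_ideal I.
  split=> [|a b c [u Uu ub] [w Uw wc]].
    by exists 0; rewrite ?scale0r ?subrr; exact: submodule0.
  exists (a *: u + w); first by apply: submoduleD => //; exact: submoduleZ.
  rewrite scalerDl -scalerA opprD addrACA -scalerBr.
  by apply: submoduleD => //; exact: submoduleZ.
have [us usU usL] : exists2 us : seq V, (forall u, u \in us -> U u) &
    forall a, lspan L a -> exists2 u, lspan us u & lspan l (u - a *: g).
  have: forall a, a \in L -> I a by move=> a aL; rewrite IL; exact: mem_lspan.
  elim: (L) => [|b L' IHL] LI.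
    by exists [::] => // a ->; exists 0; rewrite ?scale0r ?subrr //; exact: submodule0.
  have [a aL|us usU usL] := IHL; first by apply: LI; rewrite inE aL orbT.
  have [u Uu ub] := LI b (mem_head _ _).
  exists (u :: us) => [w|a [c /usL[w usw wc]]].
    by rewrite inE => /predU1P[->|/usU].
  exists (c *: u + w); first by exists c; rewrite addrC addKr.
  have -> : c *: u + w - a *: g = c *: (u - b *: g) + (w - (a - c *: b) *: g).
    by zmod_solve.
  by apply: submoduleD => //; exact: submoduleZ.
have [||l' Ul'] := IHl (U `&` lspan l); first exact: submoduleI.
  by move=> x [].
exists (us ++ l'); apply/seteqP; split=> [x Ux|].
  have [a xa] := Ul x Ux.
  have /usL[u uu ua] : lspan L a by rewrite -IL; exists x.
  have : lspan l' (x - u).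
    rewrite -Ul'; split.
      by apply: submoduleB => //; apply: (lspan_sub sU usU).
    rewrite -(subrK (a *: g) x) -addrA -[a *: g - u]opprB.
    exact: submoduleB.
  have sul := lspan_submodule (us ++ l').
  move=> xu; rewrite -(subrK u x); apply: submoduleD => //.
    apply: (lspan_sub sul _ xu) => y yl'.
    by apply: mem_lspan; rewrite mem_cat yl' orbT.
  apply: (lspan_sub sul _ uu) => y yl'.
  by apply: mem_lspan; rewrite mem_cat yl'.
apply: lspan_sub => // x; rewrite mem_cat => /orP[/usU //|/mem_lspan].
by rewrite -Ul' => -[].
Qed.

Lemma maximal_submodule V (Q : set (set V)) :
  finitely_generated V -> (forall U, Q U -> submodule U) -> Q !=set0 ->
  exists2 U, Q U & forall U', Q U' -> U `<=` U' -> U' `<=` U.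
Proof.
move=> /finitely_generatedE[l lV] Qsub [U0 QU0]; apply: contrapT => noMax.
have next (U : {U | Q U}) : exists U' : {U | Q U},
    sval U `<=` sval U' /\ ~ (sval U' `<=` sval U).
  apply: contrapT => nxt; apply: noMax; exists (sval U); first exact: svalP.
  move=> U' QU' UU'; apply: contrapT => nU'U; apply: nxt.
  by exists (exist _ U' QU').
pose c n := iter n (fun U => sval (cid (next U))) (exist _ U0 QU0).
have cS n : sval (c n) `<=` sval (c n.+1).
  by rewrite /c iterS; case: cid => U' [].
have cle n k : (n <= k)%N -> sval (c n) `<=` sval (c k).
  by move=> /subnK <-; elim: (k - n)%N => // j; move=> IH x /IH /cS.
have sc n : submodule (sval (c n)) by apply: Qsub; exact: svalP.
pose W : set V := [set x | exists n, sval (c n) x].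
have sW : submodule W.
  split=> [|a x y [i ix] [j jy]]; first by exists 0%N; exact: submodule0.
  exists (maxn i j); apply: submoduleD => //; last exact: cle (leq_maxr _ _) _ jy.
  by apply: submoduleZ => //; exact: cle (leq_maxl _ _) _ ix.
have [|l' Wl'] := @submodule_lspan _ l W sW; first by move=> x _.
have [n nl'] : exists n, forall x, x \in l' -> sval (c n) x.
  have: forall x, x \in l' -> W x by move=> x; rewrite Wl'; exact: mem_lspan.
  elim: (l') => [|x s IHs] sW'; first by exists 0%N.
  have [y ys|i si] := IHs; first by apply: sW'; rewrite inE ys orbT.
  have [j jx] := sW' x (mem_head _ _).
  exists (maxn i j) => y; rewrite inE => /predU1P[->|/si].
    exact: cle (leq_maxr _ _) _ jx.
  exact: cle (leq_maxl _ _) _.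
have : sval (c n.+1) `<=` sval (c n).
  move=> x cx; have : W x by exists n.+1.
  by rewrite Wl'; exact: lspan_sub.
by rewrite {1}/c iterS -/(c n); case: cid => U' [].
Qed.

Lemma fg_ring : finitely_generated R^o.
Proof.
apply/finitely_generatedE; exists [:: (1 : R^o)] => x /=.
by exists x; rewrite [_ *: _]mulr1 subrr.
Qed.

Lemma maximal_ideal_family (Q : set (set R)) :
  (forall I, Q I -> is_ideal I) -> Q !=set0 ->
  exists2 I, Q I & forall I', Q I' -> I `<=` I' -> I' `<=` I.
Proof. exact: (@maximal_submodule R^o Q fg_ring). Qed.

End Noetherian.

Section FiniteGeneration.
Variable R : comNzRingType.
Implicit Types (V W : lmodType R).

Lemma fg_image V W (f : {linear V -> W}) :
  (forall w, exists v, f v = w) -> finitely_generated V -> finitely_generated W.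
Proof.
move=> surjf [n [g gV]]; exists n, (f \o g) => w.
have [v <-] := surjf w; have [c ->] := gV v; exists c.
by rewrite linear_sum; apply: eq_bigr => k _; rewrite linearZ.
Qed.

Definition pair_map (U : lmodType R) V W (f : {linear U -> V})
  (g : {linear U -> W}) (u : U) : (V * W)%type := (f u, g u).
Fact pair_map_linear (U : lmodType R) V W (f : {linear U -> V}) (g : {linear U -> W}) :
  linear (pair_map f g).
Proof. by move=> a x y; rewrite /pair_map !linearP. Qed.
HB.instance Definition _ (U V W : lmodType R) (f : {linear U -> V}) (g : {linear U -> W}) :=
  GRing.isLinear.Build R U (V * W)%type *:%R (pair_map f g) (pair_map_linear f g).

Definition scale_at V (v : V) (a : R^o) : V := a *: v.
Fact scale_at_linear V (v : V) : linear (scale_at v).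
Proof. by move=> a x y; rewrite /scale_at scalerDl scalerA. Qed.
HB.instance Definition _ V (v : V) :=
  GRing.isLinear.Build R R^o V *:%R (scale_at v) (scale_at_linear v).

Lemma submodule_preim V W (f : {linear V -> W}) (U : set W) :
  submodule U -> submodule [set v | U (f v)].
Proof.
move=> sU; split=> [|a x y Ux Uy] /=; first by rewrite linear0; exact: submodule0.
by rewrite linearP; apply: submoduleD => //; exact: submoduleZ.
Qed.

Lemma fg_prod V W :
  finitely_generated V -> finitely_generated W -> finitely_generated (V * W)%type.
Proof.
move=> /finitely_generatedE[l lV] /finitely_generatedE[l' lW].
apply/finitely_generatedE.
pose il : {linear V -> (V * W)%type} := pair_map idfun \0.
pose ir : {linear W -> (V * W)%type} := pair_map \0 idfun.
exists (map il l ++ map ir l') => -[v w].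
have sL := lspan_submodule (map il l ++ map ir l').
have -> : (v, w) = il v + ir w by apply: injective_projections; rewrite /= ?addr0 ?add0r.
apply: submoduleD => //.
  apply: (lspan_sub (submodule_preim il sL) _ (lV v)) => x xl; apply: mem_lspan.
  by rewrite mem_cat map_f.
apply: (lspan_sub (submodule_preim ir sL) _ (lW w)) => x xl; apply: mem_lspan.
by rewrite mem_cat map_f ?orbT.
Qed.

End FiniteGeneration.

(** * Prime avoidance and local rings *)

Section Regularity.
Variables (R : comNzRingType) (m : set R).
Implicit Types (V W : lmodType R).

Definition regular_mod V (U : set V) (x : R) : Prop :=
  forall v, U (x *: v) -> U v.

Definition has_socle V (U : set V) : Prop :=
  exists2 v, ~ U v & forall a, m a -> U (a *: v).

Lemma regular_mod_socle V (U : set V) x : m x -> regular_mod U x -> ~ has_socle U.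
Proof. by move=> mx rx [v nUv mv]; apply/nUv/rx/mv. Qed.

Lemma has_socleX V W (U : set V) (U' : set W) :
  has_socle (U `*` U') -> has_socle U \/ has_socle U'.
Proof.
move=> [[v w] nU mU]; have [Uv|nUv] := pselect (U v).
  by right; exists w => [U'w|a /mU[]//]; apply: nU.
by left; exists v => // a /mU[].
Qed.

Lemma regular_modX V W (U : set V) (U' : set W) x :
  submodule U -> submodule U' -> regular_mod (U `*` U') x ->
  regular_mod U x /\ regular_mod U' x.
Proof.
move=> sU sU' rx; split=> v Uv.
  have /rx[]// : (U `*` U') (x *: ((v, 0) : (V * W)%type)).
  split; first exact: Uv.
  by change (U' (x *: 0)); rewrite scaler0; exact: submodule0.
have /rx[] // : (U `*` U') (x *: ((0, v) : (V * W)%type)).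
split; last exact: Uv.
by change (U (x *: 0)); rewrite scaler0; exact: submodule0.
Qed.

End Regularity.

Section PrimeAvoidance.
Variables (R : comNzRingType) (m : set R).
Hypotheses (noethR : noetherian R) (idm : is_ideal m).
Variables (V : lmodType R) (U : set V).
Hypotheses (fgV : finitely_generated V) (sU : submodule U).

Let ann v : set R := [set a | U (a *: v)].

Let annL v : is_ideal (ann v).
Proof.
split=> [|a x y]; rewrite /ann /= ?scale0r; first exact: submodule0.
move=> Ux Uy; rewrite scalerDl -scalerA.
by apply: submoduleD => //; exact: submoduleZ.
Qed.

(* The associated primes of V/U which are maximal among annihilators. *)
Let maxann v := ~ U v /\ forall w, ~ U w -> ann v `<=` ann w -> ann w `<=` ann v.

Let maxann_exists v : ~ U v -> exists2 w, maxann w & ann v `<=` ann w.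
Proof.
move=> nUv.
have [||I [w [nUw vw Iw] Imax]] := @maximal_ideal_family _ noethR
  [set I | exists w, [/\ ~ U w, ann v `<=` ann w & I = ann w]].
- by move=> I [w [_ _ ->]].
- by exists (ann v); exists v; split.
exists w => //; split=> // w' nUw' ww'; rewrite -Iw; apply: Imax; rewrite ?Iw //.
by exists w'; split=> //; apply: subset_trans ww'.
Qed.

Let maxann_prime v a b : maxann v -> ann v (a * b) -> ann v a \/ ann v b.
Proof.
move=> [nUv vmax] vab; have [vb|nvb] := pselect (ann v b); [by right|left].
apply: (vmax (b *: v)); rewrite /ann //= ?scalerA // => c vc /=.
by rewrite scalerA mulrC -scalerA; exact: submoduleZ.
Qed.

Let ann_separate (l : seq V) w : maxann w ->
  (forall v, v \in l -> ~ (ann v `<=` ann w)) ->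
  exists2 c, (forall v, v \in l -> ann v c) & ~ ann w c.
Proof.
move=> mw; elim: l => [|v l IHl] lw.
  by exists 1 => //; rewrite /ann /= scale1r; case: mw.
have [u ul|c lc nwc] := IHl; first by apply: lw; rewrite inE ul orbT.
have [d dv nwd] : exists2 d, ann v d & ~ ann w d.
  apply: contrapT => no; apply: (lw v); rewrite ?mem_head // => d dv.
  by apply: contrapT => nwd; apply: no; exists d.
exists (d * c) => [u|/(maxann_prime mw)[]//].
rewrite inE => /predU1P[->|/lc uc].
  by rewrite /ann /= mulrC -scalerA; exact: submoduleZ.
by rewrite /ann /= -scalerA; exact: submoduleZ.
Qed.

Let maxann_finite : exists2 l : seq V, (forall v, v \in l -> maxann v) &
  forall w, maxann w -> exists2 v, v \in l & ann w `<=` ann v.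
Proof.
pose S (l : seq V) := [set x | exists2 u, lspan l u & U (x - u)].
have [||_ [l lmax ->] Smax] := @maximal_submodule _ noethR V
  [set W | exists2 l : seq V, (forall v, v \in l -> maxann v) & W = S l] fgV.
- move=> _ [l _ ->]; have sl := lspan_submodule l.
  split=> [|a x y [u lu xu] [v lv yv]].
    by exists 0; rewrite ?subr0; exact: submodule0.
  exists (a *: u + v); first by apply: submoduleD => //; exact: submoduleZ.
  have -> : a *: x + y - (a *: u + v) = a *: (x - u) + (y - v) by zmod_solve.
  by apply: submoduleD => //; exact: submoduleZ.
- by exists (S [::]), [::].
exists l => // w mw; apply: contrapT => no.
have [u lu wu] : S l w.
  apply: (Smax (S (w :: l))).
  - by exists (w :: l) => // v; rewrite inE => /predU1P[->|/lmax].
    move=> x [u lu xu]; exists u => //; exists 0.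
    by rewrite scale0r subr0.
  exists w; last by rewrite subrr; exact: submodule0.
  by apply: mem_lspan; rewrite mem_head.
have [v vl vw|c lc nwc] := @ann_separate l w mw.
  by apply: no; exists v => //; case: (lmax _ vl) => _; apply=> //; case: mw.
apply: nwc; rewrite /ann /= -(subrK u w) scalerDr.
apply: submoduleD => //; first exact: submoduleZ.
apply: (@lspan_sub _ _ l [set x | U (c *: x)]) => //.
split=> [|a x y Ux Uy] /=; first by rewrite scaler0; exact: submodule0.
rewrite scalerDr scalerA mulrC -scalerA.
by apply: submoduleD => //; exact: submoduleZ.
Qed.

Lemma prime_avoidance : ~ has_socle m U -> exists2 x, m x & regular_mod U x.
Proof.
move=> nsoc; have [l lmax lfin] := maxann_finite.
suff [x mx xl] : exists2 x, m x & forall v, v \in l -> ~ ann v x.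
  exists x => // v xv; apply: contrapT => nUv.
  have [w mw vw] := maxann_exists nUv; have [u ul wu] := lfin w mw.
  by apply: (xl u ul); apply/wu/vw.
elim: l lmax {lfin} => [|v l IHl] lmax; first by exists 0; case: idm.
have [u ul|x mx xl] := IHl; first by apply: lmax; rewrite inE ul orbT.
have vmax : maxann v by apply: lmax; rewrite mem_head.
have [vx|nvx] := pselect (ann v x); last first.
  by exists x => // u; rewrite inE => /predU1P[->|/xl].
have [u ul uv|c lc nvc] := @ann_separate l v vmax.
  have [|_ umax] := lmax u; first by rewrite inE ul orbT.
  by apply: (xl u ul); apply: umax vx => //; case: vmax.
have [b mb nvb] : exists2 b, m b & ~ ann v b.
  apply: contrapT => no; apply: nsoc; exists v; first by case: vmax.
  by move=> a ma; apply: contrapT => nva; apply: no; exists a.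
exists (c * b + x) => [|u]; first by case: idm => _; apply.
rewrite inE => /predU1P[-> vcbx|ul ucbx].
  have : ann v (c * b).
    have [_ /(_ (-1) _ _ vx vcbx)] := annL v.
    by rewrite mulN1r addrC addrK.
  by case/(maxann_prime vmax).
apply: (xl u ul); have -> : x = - b * c + (c * b + x) by rewrite mulNr [b * c]mulrC addKr.
by case: (annL u) => _; apply=> //; exact: lc.
Qed.

End PrimeAvoidance.

Section LocalRing.
Variables (R : comNzRingType) (m : set R).
Hypotheses (noethR : noetherian R) (localR : local_ring m).
Implicit Types (V W : lmodType R).

Lemma local_ideal : is_ideal m.
Proof. by case: localR => -[]. Qed.

Lemma local_mull a x : m x -> m (a * x).
Proof. by case: local_ideal => m0 mD mx; rewrite -[a * x]addr0; exact: mD. Qed.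

Lemma local_add x y : m x -> m y -> m (x + y).
Proof. by case: local_ideal => _ mD mx my; rewrite -[x]mul1r; exact: mD. Qed.

Lemma local_proper : ~ m 1.
Proof. by case: localR => -[]. Qed.

Lemma local_submodule : @submodule R R^o m.
Proof. exact: local_ideal. Qed.

Lemma local_unit a : ~ m a -> exists b, b * a = 1.
Proof.
move=> nma; apply: contrapT => nua.
pose I : set R := [set c | exists b, b * a = c].
have [||J [idJ nJ1 IJ] Jmax] := @maximal_ideal_family _ noethR
  [set J | [/\ is_ideal J, ~ J 1 & I `<=` J]].
- by move=> J [].
- exists I; split=> //; split=> [|c _ _ [b <-] [d <-]].
    by exists 0; rewrite mul0r.
  by exists (c * b + d); rewrite mulrDl mulrA.
have [_ locm] := localR; apply/nma; rewrite -(locm J).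
  by apply: IJ; exists 1; rewrite mul1r.
split=> // K idK nK1 JK; apply: Jmax => //; split=> //.
exact: subset_trans JK.
Qed.

Lemma local_sub1_unit a : m a -> exists b, b * (1 - a) = 1.
Proof.
move=> ma; apply: local_unit => m1a; apply: local_proper.
by rewrite -(subrK a 1); exact: local_add.
Qed.

Definition maximal_multiple V : set V :=
  [set v | exists2 s : seq R, (forall x, x \in s -> m x) & genby s setT v].

Lemma nakayama V : finitely_generated V ->
  (forall v : V, maximal_multiple v) -> ~ nonzero V.
Proof.
move=> /finitely_generatedE[l + mV].
elim: l => [V0 [v /eqP nz]|g l IHl lV]; first by apply/nz/V0.
apply: IHl; have sl := lspan_submodule l.
have [a ma ga] : exists2 a, m a & lspan l (g - a *: g).
  have [s sm] := mV g.
  apply: (@genby_min _ _ _ _ [set v | exists2 a, m a & lspan l (v - a *: g)]).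
    split=> [|a x y [b mb xb] [c mc yc]].
      exists 0; first by case: local_ideal.
      by rewrite scale0r subr0; exact: submodule0.
    exists (a * b + c); first by case: local_ideal => _; apply.
    have -> : a *: x + y - (a * b + c) *: g = a *: (x - b *: g) + (y - c *: g).
      by zmod_solve.
    by apply: submoduleD => //; exact: submoduleZ.
  move=> x v /sm mx _; have [a va] := lV v; exists (a * x).
    exact: local_mull.
  have -> : x *: v - (a * x) *: g = x *: (v - a *: g).
    by rewrite mulrC; zmod_solve.
  exact: submoduleZ.
have [b ba] := local_sub1_unit ma.
have lg : lspan l g.
  have -> : g = b *: (g - a *: g).
    by rewrite -[X in X - _]scale1r -scalerBl scalerA ba scale1r.
  exact: submoduleZ.
move=> v; have [c vc] := lV v; rewrite -(subrK (c *: g) v).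
by apply: submoduleD => //; exact: submoduleZ.
Qed.

Lemma maximal_multiple_map V W (f : {linear V -> W}) v :
  maximal_multiple v -> maximal_multiple (f v).
Proof. by move=> [s sm sv]; exists s => //; exact: genby_map sv. Qed.

Lemma maximal_multiple_ring (a : R^o) : maximal_multiple a -> m a.
Proof.
move=> [s sm]; apply: (genby_min local_submodule) => x v /sm mx _.
by rewrite [x *: v]mulrC; exact: local_mull.
Qed.

Lemma maximal_multiple_submodule V : submodule (@maximal_multiple V).
Proof.
split=> [|a x y [s sm sx] [t tm ty]].
  by exists [::].
exists (s ++ t) => [z|]; first by rewrite mem_cat => /orP[/sm|/tm].
have st := genby_submodule (s ++ t) (@submodule_setT _ V).
apply: submoduleD => //; first apply: submoduleZ => //.
  by apply: genby_subset sx => // z; rewrite mem_cat => ->.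
by apply: genby_subset ty => // z; rewrite mem_cat orbC => ->.
Qed.

Lemma maximal_multipleZ V a (v : V) : m a -> maximal_multiple (a *: v).
Proof.
by move=> ma; exists [:: a] => [x|]; [rewrite inE => /eqP->|apply: genby_head].
Qed.

Lemma exists_not_maximal_multiple V : finitely_generated V -> nonzero V ->
  exists v : V, ~ maximal_multiple v.
Proof.
move=> fgV V0; apply: contrapT => no; apply: nakayama fgV _ V0 => v.
by apply: contrapT => nv; apply: no; exists v.
Qed.

End LocalRing.

(** * Regular sequences *)

Section Depth.
Variables (R : comNzRingType) (m : set R).
Hypotheses (noethR : noetherian R) (localR : local_ring m).
Implicit Types (V : lmodType R) (s t : seq R).

Notation mult V s := (genby s (@setT (GRing.Lmodule.sort V))).

Lemma mult_submodule V s : submodule (mult V s).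
Proof. exact: (genby_submodule s (@submodule_setT _ V)). Qed.

Lemma mult_swap V x y s : mult V (x :: y :: s) = mult V (y :: x :: s).
Proof.
apply: (eq_genby (@submodule_setT _ V)) => z.
by rewrite !inE orbCA.
Qed.

(* Some V/(s)V-regular sequence of length n cannot be prolonged: by prime
   avoidance this means that the last quotient has a socle. *)
Fixpoint maximal_regular V n s : Prop :=
  if n is n'.+1 then
    exists x, [/\ m x, regular_mod (mult V s) x & maximal_regular V n' (x :: s)]
  else has_socle m (mult V s).

Lemma maximal_regular_ext V n s t :
  mult V s = mult V t -> maximal_regular V n s -> maximal_regular V n t.
Proof.
elim: n s t => [|n IHn] s t /= st; first by rewrite st.
move=> [x [mx rx xs]]; exists x; split=> //; first by rewrite -st.
apply: IHn xs; apply/seteqP.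
by split=> v [w _ vw]; exists w => //; [rewrite -st|rewrite st].
Qed.

Lemma socle_exchange V s x y : m x -> m y ->
  regular_mod (mult V s) x -> regular_mod (mult V s) y ->
  has_socle m (mult V (x :: s)) -> has_socle m (mult V (y :: s)).
Proof.
move=> mx my rx ry [v nv mv]; have [w _ yv] := mv y my.
have ss := mult_submodule V s.
exists w => [[u _ wu]|a ma].
  apply: nv; exists u => //; apply: ry.
  have -> : y *: (v - x *: u) = (y *: v - x *: w) + x *: (w - y *: u).
    by rewrite !scalerBr !scalerA [x * y]mulrC; zmod_solve.
  by apply: submoduleD => //; exact: submoduleZ.
have [u _ au] := mv a ma; exists u => //; apply: rx.
have -> : x *: (a *: w - y *: u) = y *: (a *: v - x *: u) - a *: (y *: v - x *: w).
  by rewrite !scalerBr !scalerA [x * a]mulrC [x * y]mulrC [y * a]mulrC; zmod_solve.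
by apply: submoduleB => //; exact: submoduleZ.
Qed.

Lemma regular_exchange V s x w :
  regular_mod (mult V s) x -> regular_mod (mult V s) w ->
  regular_mod (mult V (x :: s)) w -> regular_mod (mult V (w :: s)) x.
Proof.
move=> rx rw rxw a [b _ xab]; have ss := mult_submodule V s.
have [c _ bc] : mult V (x :: s) b.
  apply: rxw; exists a => //; rewrite -opprB; exact: submoduleN.
exists c => //; apply: rx.
have -> : x *: (a - w *: c) = (x *: a - w *: b) + w *: (b - x *: c).
  by rewrite !scalerBr !scalerA [x * w]mulrC; zmod_solve.
by apply: submoduleD => //; exact: submoduleZ.
Qed.

(* With y the first element of the given maximal sequence, prime avoidance yields
   a w that is regular modulo s, modulo (x, s) and modulo (y, s); induction
   replaces y by w and then w by x. *)
Lemma maximal_regular_cons V n s x : finitely_generated V ->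
  m x -> regular_mod (mult V s) x -> maximal_regular V n s ->
  exists2 k, n = k.+1 & maximal_regular V k (x :: s).
Proof.
move=> fgV; elim: n s x => [|[|k] IHk] s x mx rx.
- by move/(regular_mod_socle mx rx).
- by case=> y [my ry socy]; exists 0%N => //; apply: socle_exchange socy.
move=> [y [my ry ysk]]; exists k.+1 => //.
have nsocy : ~ has_socle m (mult V (y :: s)).
  by case: ysk => z [mz rz _]; exact: regular_mod_socle rz.
have nsocx : ~ has_socle m (mult V (x :: s)).
  by move=> socx; apply/nsocy/(socle_exchange _ _ _ _ socx).
have nsoc : ~ has_socle m (mult V s) by exact: regular_mod_socle rx.
have sxy := submoduleX (mult_submodule V (x :: s)) (mult_submodule V (y :: s)).
have [w mw] : exists2 w, m w &
    regular_mod (mult V s `*` (mult V (x :: s) `*` mult V (y :: s))) w.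
  apply: prime_avoidance => //; first exact: local_ideal.
  - by do 2?apply: fg_prod.
  - by apply: submoduleX => //; exact: mult_submodule.
  - by case/has_socleX => // /has_socleX[].
case/regular_modX => //; first exact: mult_submodule.
move=> rw /regular_modX[||rwx rwy]; try exact: mult_submodule.
have [_ [<-] wysk] := IHk _ _ mw rwy ysk.
have [_ [<-] xwsk] : exists2 k', k.+1 = k'.+1 & maximal_regular V k' (x :: w :: s).
  apply: IHk => //; first exact: regular_exchange.
  exists y; split=> //; first exact: regular_exchange.
  by apply: maximal_regular_ext wysk; exact: mult_swap.
exists w; split=> //.
by apply: maximal_regular_ext xwsk; exact: mult_swap.
Qed.

(* The most recently added element comes first. *)
Fixpoint regular_chain V s : Prop :=
  if s is x :: s' then
    [/\ m x, regular_mod (mult V s') x & regular_chain V s'] else True.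

Lemma regular_chain_mem V s : regular_chain V s -> forall x, x \in s -> m x.
Proof.
elim: s => // x s IHs [mx _ /IHs sm] y; rewrite inE => /predU1P[->//|].
exact: sm.
Qed.

Lemma maximal_regular_cat V k t s :
  regular_chain V (t ++ s) -> maximal_regular V k (t ++ s) ->
  maximal_regular V (k + size t) s.
Proof.
elim: t k => [|x t IHt] k /=; first by rewrite addn0.
by move=> [mx rx ts] xts; rewrite addnS -addSn; apply: IHt => //; exists x.
Qed.

Lemma maximal_regular_chain V n s :
  regular_chain V s -> maximal_regular V n s ->
  exists t, [/\ regular_chain V t, has_socle m (mult V t) & size t = (n + size s)%N].
Proof.
elim: n s => [|n IHn] s cs /=; first by exists s.
move=> [x [mx rx /IHn[//|t [ct soct st]]]]; exists t; split=> //.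
by rewrite st addnS addSn.
Qed.

Lemma maximal_regular_max V n t : finitely_generated V ->
  maximal_regular V n [::] -> regular_chain V t ->
  exists2 k, n = (k + size t)%N & maximal_regular V k t.
Proof.
move=> fgV maxn; elim: t => [|x t IHt] /=; first by exists n; rewrite ?addn0.
move=> [mx rx /IHt[k -> kt]].
by have [k' -> xt] := maximal_regular_cons fgV mx rx kt; exists k'; rewrite ?addnS ?addSn.
Qed.

Lemma regular_chainP V s : regular_chain V (rev s) <->
  (forall x, x \in s -> m x) /\
  forall i, (i < size s)%N -> forall v : V,
     in_seq_submodule (take i s) (s`_i *: v) -> in_seq_submodule (take i s) v.
Proof.
have mulE t : mult V (rev t) = mult V t.
  by apply: (eq_genby (@submodule_setT _ V)) => x; rewrite mem_rev.
elim/last_ind: s => [|s x IHs]; first by split.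
rewrite rev_rcons /= size_rcons mulE; split.
  move=> [mx rx /IHs[sm rs]]; split=> [y|i].
    by rewrite mem_rcons inE => /predU1P[->//|/sm].
  rewrite ltnS leq_eqVlt => /predU1P[->|lt_is] v.
    rewrite nth_rcons ltnn eqxx -cats1 take_size_cat //.
    by move=> /in_seq_submoduleE/rx/in_seq_submoduleE.
  rewrite nth_rcons lt_is -cats1 takel_cat; last exact: ltnW.
  exact: rs.
move=> [sm rs]; split.
- by apply: sm; rewrite mem_rcons mem_head.
- move=> v /in_seq_submoduleE sv; have := rs (size s) (leqnn _) v.
  rewrite nth_rcons ltnn eqxx -cats1 take_size_cat //.
  by move/(_ sv)/in_seq_submoduleE.
apply/IHs; split=> [y ys|i lt_is v].
  by apply: sm; rewrite mem_rcons inE ys orbT.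
have := rs i (ltnW lt_is) v.
by rewrite nth_rcons lt_is -cats1 takel_cat //; exact: ltnW.
Qed.

Lemma eint_sup_max (A : set (\bar int)) x :
  A x -> (forall y, A y -> (y <= x)%E) -> eint_sup A = x.
Proof.
move=> Ax xA; have supx : supremums A x by split=> // y; exact.
rewrite /eint_sup /supremum ifF; last by apply/negbTE/set0P; exists x.
by apply: xget_subset1 supx _; exact: is_subset1_supremums.
Qed.

Lemma eint_inf_min (A : set (\bar int)) x :
  A x -> (forall y, A y -> (x <= y)%E) -> eint_inf A = x.
Proof.
move=> Ax xA; have infx : infimums A x by split=> // y; exact.
rewrite /eint_inf /infimum ifF; last by apply/negbTE/set0P; exists x.
by apply: xget_subset1 infx _; exact: is_subset1_infimums.
Qed.

Lemma depthE V n : finitely_generated V -> maximal_regular V n [::] ->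
  depth m V = n%:Z%:E.
Proof.
move=> fgV maxn; apply: eint_sup_max.
  have [t [ct [v nv _] st]] := @maximal_regular_chain _ _ [::] I maxn.
  exists (rev t); last by rewrite size_rev st addn0.
  have /regular_chainP[tm rt] : regular_chain V (rev (rev t)) by rewrite revK.
  split=> //; split=> //; exists v => /in_seq_submoduleE tv; apply: nv.
  by apply: genby_subset tv => // x; rewrite mem_rev.
move=> _ [s [sm [rs _]] <-]; rewrite lee_fin lez_nat.
have /(maximal_regular_max fgV maxn)[k -> _] : regular_chain V (rev s).
  exact/regular_chainP.
by rewrite size_rev leq_addl.
Qed.

Lemma genby_proper V s : finitely_generated V -> nonzero V ->
  (forall x, x \in s -> m x) -> exists v : V, ~ mult V s v.
Proof.
move=> fgV V0 sm; have [v nv] := exists_not_maximal_multiple noethR localR fgV V0.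
by exists v => sv; apply: nv; exists s.
Qed.

Lemma regular_not_mem V s x : finitely_generated V -> nonzero V ->
  (forall x, x \in s -> m x) -> regular_mod (mult V s) x ->
  ~ mult (R^o : lmodType R) s x.
Proof.
move=> fgV V0 sm rx sx; have [v nv] := genby_proper fgV V0 sm.
apply/nv/rx.
apply: (genby_min (submodule_preim (scale_at v) (mult_submodule V s)) _ sx).
move=> y c ys _ /=; rewrite /scale_at.
by rewrite -scalerA; exact: genby_mem.
Qed.

End Depth.

(** * Vanishing of Ext *)

Section ExactSequences.
Variable R : comNzRingType.
Implicit Types (A B C E K M Q X Y Z : lmodType R).

Definition ses A B C (i : {linear A -> B}) (p : {linear B -> C}) : Prop :=
  [/\ injective i, forall c, exists b, p b = c &
      forall b, p b = 0 <-> exists a, i a = b].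

Lemma linear_inj A B (f : {linear A -> B}) :
  (forall a, f a = 0 -> a = 0) -> injective f.
Proof.
move=> f0 x y fxy; apply/eqP; rewrite -subr_eq0; apply/eqP/f0.
by rewrite linearB fxy subrr.
Qed.

Lemma linear_factor B C X (p : {linear B -> C}) (f : {linear B -> X}) :
  (forall c, exists b, p b = c) -> (forall b, p b = 0 -> f b = 0) ->
  exists g : {linear C -> X}, forall b, g (p b) = f b.
Proof.
move=> surjp kerp; pose g c := f (sval (cid (surjp c))).
have gE b : g (p b) = f b.
  rewrite /g; case: cid => b' /= pb'; apply/eqP; rewrite -subr_eq0 -linearB.
  by apply/eqP/kerp; rewrite linearB pb' subrr.
have g_lin : linear g.
  move=> a x y; have [[b <-] [b' <-]] := (surjp x, surjp y).
  by rewrite -linearP !gE linearP.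
pose gL : {linear C -> X} := HB.pack g (GRing.isLinear.Build _ _ _ _ g g_lin).
by exists gL.
Qed.

Lemma linear_lift A B X (i : {linear A -> B}) (f : {linear X -> B}) :
  injective i -> (forall x, exists a, i a = f x) ->
  exists g : {linear X -> A}, forall x, i (g x) = f x.
Proof.
move=> inji imf; pose g x := sval (cid (imf x)).
have gE x : i (g x) = f x by rewrite /g; case: cid.
have g_lin : linear g by move=> a x y; apply: inji; rewrite linearP !gE linearP.
pose gL : {linear X -> A} := HB.pack g (GRing.isLinear.Build _ _ _ _ g g_lin).
by exists gL.
Qed.

Definition kernel_incl B C (f : {linear B -> C}) : {linear kernel f -> B} := val.

Lemma kernel_incl_inj B C (f : {linear B -> C}) : injective (kernel_incl f).
Proof. exact: val_inj. Qed.

Lemma kernel_inclP B C (f : {linear B -> C}) b :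
  f b = 0 <-> exists k, kernel_incl f k = b.
Proof.
split=> [fb|[[k kK] <-]]; last exact/eqP.
have bK : b \in kernel_pred f by rewrite inE fb.
by exists (Kernel bK).
Qed.

Lemma kernel_ses B C (f : {linear B -> C}) :
  (forall c, exists b, f b = c) -> ses (kernel_incl f) f.
Proof. by move=> surjf; split=> //; [exact: kernel_incl_inj|exact: kernel_inclP]. Qed.

Lemma ses_sub0 A B C (i : {linear A -> B}) (p : {linear B -> C}) a :
  ses i p -> p (i a) = 0.
Proof. by move=> [_ _ ex]; apply/ex; exists a. Qed.

Lemma coker_exists A B (g : {linear A -> B}) :
  exists C (p : {linear B -> C}), (forall c, exists b, p b = c) /\
    forall b, p b = 0 <-> exists a, g a = b.
Proof.
have [l lE] : exists l : {linear B -> kernel (\0 : {linear B -> B})},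
    forall b, kernel_incl _ (l b) = b.
  by apply: (@linear_lift _ _ _ _ idfun) => [|b]; [exact: kernel_incl_inj|exact/kernel_inclP].
exists (homology g (\0 : {linear B -> B})), (@homology_class _ _ _ _ g \0 \o l).
split=> [|b]; last first.
  have := @homology_class_eq0 _ _ _ _ g \0 (l b).
  have -> : kernel_val (l b) = b := lE b.
  by case=> h1 h2; split=> [/= /eqP/h1|/h2/eqP].
elim/homology_ind => z; exists (kernel_incl _ z) => /=; congr homology_class.
by apply: (@kernel_incl_inj _ _ \0); rewrite lE.
Qed.

Lemma image_exists A B (g : {linear A -> B}) :
  exists C (e : {linear A -> C}) (j : {linear C -> B}),
    [/\ forall c, exists a, e a = c, injective j & forall a, j (e a) = g a].
Proof.
have [C [e [surje kere]]] := coker_exists (kernel_incl g).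
have [j jE] : exists j : {linear C -> B}, forall a, j (e a) = g a.
  by apply: linear_factor => // a /kere/kernel_inclP.
exists C, e, j; split=> //; apply: linear_inj => c.
by have [a <-] := surje c; rewrite jE => /kernel_inclP/kere.
Qed.

Lemma projective_retract A B (s : {linear A -> B}) (r : {linear B -> A}) :
  (forall a, r (s a) = a) -> projective B -> projective A.
Proof.
move=> rs projB V W p f surjp; have [h hE] := projB V W p (f \o r) surjp.
by exists (h \o s) => a /=; rewrite hE /= rs.
Qed.

Definition copair A B C (f : {linear A -> C}) (g : {linear B -> C})
  (x : (A * B)%type) : C := f x.1 + g x.2.
Fact copair_linear A B C (f : {linear A -> C}) (g : {linear B -> C}) :
  linear (copair f g).
Proof. by move=> a x y; rewrite /= /copair !linearP /=; zmod_solve. Qed.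
HB.instance Definition _ A B C (f : {linear A -> C}) (g : {linear B -> C}) :=
  GRing.isLinear.Build R (A * B)%type C *:%R (copair f g) (copair_linear f g).

Lemma projective_prod A B : projective A -> projective B -> projective (A * B)%type.
Proof.
move=> projA projB V W p f surjp.
have [hA hAE] := projA V W p (f \o pair_map idfun \0) surjp.
have [hB hBE] := projB V W p (f \o pair_map \0 idfun) surjp.
exists (copair hA hB) => -[a b] /=; rewrite linearD hAE hBE /= -linearD.
by congr (f _); apply: injective_projections; rewrite /= ?addr0 ?add0r.
Qed.

Lemma projective_section B C (p : {linear B -> C}) :
  (forall c, exists b, p b = c) -> projective C ->
  exists s : {linear C -> B}, forall c, p (s c) = c.
Proof. by move=> surjp projC; exact: (projC _ _ p idfun surjp). Qed.

Lemma pullback_exists X Y Z (p : {linear X -> Z}) (q : {linear Y -> Z}) :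
  exists E (a : {linear E -> X}) (b : {linear E -> Y}),
    [/\ forall e, p (a e) = q (b e),
        forall x y, p x = q y -> exists2 e, a e = x & b e = y &
        forall e, a e = 0 -> b e = 0 -> e = 0].
Proof.
pose d : {linear (X * Y)%type -> Z} := copair p (\- q).
exists (kernel d), (fst \o kernel_incl d), (snd \o kernel_incl d); split=> [e|x y xy|e ae be].
- apply/eqP; rewrite -subr_eq0; apply/eqP.
  by have /kernel_inclP : exists k, kernel_incl d k = kernel_incl d e by exists e.
- have /kernel_inclP[e eE] : d (x, y) = 0 by rewrite /d /= /copair /= xy subrr.
  by exists e; [change ((kernel_incl d e).1 = x)|change ((kernel_incl d e).2 = y)];
    rewrite eE.
apply: (@kernel_incl_inj _ _ d); rewrite linear0.
exact: injective_projections.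
Qed.

Lemma pullback_ses K X Y Z E (i : {linear K -> X}) (p : {linear X -> Z})
    (q : {linear Y -> Z}) (a : {linear E -> X}) (b : {linear E -> Y}) :
  ses i p -> (forall e, p (a e) = q (b e)) ->
  (forall x y, p x = q y -> exists2 e, a e = x & b e = y) ->
  (forall e, a e = 0 -> b e = 0 -> e = 0) ->
  exists2 k : {linear K -> E}, ses k b & forall x, a (k x) = i x.
Proof.
move=> [inji surjp exip] pq univ inj0.
have injab : injective (pair_map a b).
  by apply: linear_inj => e [ae be]; exact: inj0.
have [k kE] : exists k : {linear K -> E}, forall x, pair_map a b (k x) = pair_map i \0 x.
  apply: linear_lift => // x; have [|e ae be] := univ (i x) 0.
    by rewrite linear0; apply/exip; exists x.
  by exists e; rewrite /= /pair_map ae be.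
have ak x : a (k x) = i x by case: (kE x).
have bk x : b (k x) = 0 by case: (kE x).
exists k => //; split=> [|y|e].
- by move=> x y kxy; apply: inji; rewrite -!ak kxy.
- by have [x xy] := surjp (q y); have [e _ <-] := univ _ _ xy; exists e.
split=> [be|[x <-]//].
have /exip[x xa] : p (a e) = 0 by rewrite pq be linear0.
by exists x; apply: injab; rewrite /= /pair_map ak bk be xa.
Qed.

Lemma zero_module_projective : projective ('rV[R]_0 : lmodType R).
Proof. by apply: zero_projective => -[x /eqP]; apply; apply/matrixP => ? []. Qed.

Lemma ses_zeror A B (f : {linear A -> B}) :
  bijective f -> ses f (\0 : {linear B -> 'rV[R]_0}).
Proof.
move=> [g fK gK]; split; first exact: can_inj fK.
  by move=> c; exists 0; apply/matrixP => ? [].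
by move=> b; split=> // _; exists (g b).
Qed.

End ExactSequences.

Section ExtVanishing.
Variables (R : comNzRingType) (N : lmodType R).
Implicit Types (A B C E K M Q X Y Z : lmodType R).

Definition extends K Q (i : {linear K -> Q}) : Prop :=
  forall f : {linear K -> N}, exists g : {linear Q -> N}, forall k, g (i k) = f k.

(* The vanishing of Ext^(j+1)(X, N). *)
Fixpoint ext_vanishes j X : Prop :=
  if j is j'.+1 then exists K Q (i : {linear K -> Q}) (p : {linear Q -> X}),
    [/\ ses i p, projective Q & ext_vanishes j' K]
  else forall K Q (i : {linear K -> Q}) (p : {linear Q -> X}), ses i p -> extends i.

Lemma ext_vanishes0_projective X : projective X -> ext_vanishes 0 X.
Proof.
move=> projX K Q i p [inji surjp exip] f.
have [s ps] := projective_section surjp projX.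
have [r rE] : exists r : {linear Q -> K}, forall q, i (r q) = (idfun \- (s \o p)) q.
  by apply: linear_lift => // q; apply/exip; rewrite /= linearB ps subrr.
exists (f \o r) => k /=; congr (f _); apply: inji; rewrite rE /=.
by have /exip -> : exists k', i k' = i k; [exists k|rewrite linear0 subr0].
Qed.

Lemma ext_vanishes0_ses X Y Z (i : {linear X -> Y}) (p : {linear Y -> Z}) :
  ses i p -> ext_vanishes 0 X -> ext_vanishes 0 Z -> ext_vanishes 0 Y.
Proof.
move=> [inji surjp exip] vX vZ K Q i' p' [inji' surjp' exip'] f.
have surjpp c : exists q, (p \o p') q = c.
  by have [y <-] := surjp c; have [q <-] := surjp' y; exists q.
pose j := kernel_incl (p \o p').
have [k kE] : exists k : {linear K -> kernel (p \o p')}, forall x, j (k x) = i' x.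
  apply: linear_lift => [|x]; first exact: kernel_incl_inj.
  apply/kernel_inclP => /=; have /exip' -> : exists k, i' k = i' x by exists x.
  by rewrite linear0.
have [r rE] : exists r : {linear kernel (p \o p') -> X}, forall x, i (r x) = p' (j x).
  apply: (@linear_lift _ _ _ _ _ (p' \o j)) => // x; apply/exip.
  by apply/(kernel_inclP (p \o p')); exists x.
have [|f1 f1E] := vX _ _ k r _ f.
  split=> [|x|x].
  - by move=> x y kxy; apply: inji'; rewrite -!kE kxy.
  - have [q qx] := surjp' (i x).
    have /kernel_inclP[z zq] : (p \o p') q = 0 by rewrite /= qx; apply/exip; exists x.
    by exists z; apply: inji; rewrite rE /j zq.
  split=> [rx|[z <-]].
    have /exip'[z zx] : p' (j x) = 0 by rewrite -rE rx linear0.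
    by exists z; apply: (@kernel_incl_inj _ _ _ (p \o p')); rewrite -zx -kE.
  by apply: inji; rewrite rE kE linear0; apply/exip'; exists z.
have [g gE] := vZ _ _ _ _ (kernel_ses surjpp) f1.
by exists g => x; rewrite -kE gE f1E.
Qed.

Lemma ext_vanishes_add_projective j A B C (i : {linear A -> B}) (p : {linear B -> C}) :
  ses i p -> projective C -> ext_vanishes j A <-> ext_vanishes j B.
Proof.
move=> sesip projC; have [inji surjp exip] := sesip.
have [s sE] := projective_section surjp projC.
case: j => [|j]; split.
- move=> vA; apply: (ext_vanishes0_ses sesip) => //.
  exact: ext_vanishes0_projective.
- move=> vB K Q i' p' sesip' f.
  have [r rE] : exists r : {linear B -> A}, forall b, i (r b) = (idfun \- (s \o p)) b.
    by apply: linear_lift => // b; apply/exip; rewrite /= linearB sE subrr.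
  have ri a : r (i a) = a.
    by apply: inji; rewrite rE /= (ses_sub0 _ sesip) linear0 subr0.
  have [E [a [b [pa univ inj0]]]] := pullback_exists p' r.
  have [k sesk ak] := pullback_ses sesip' pa univ inj0.
  have [g gE] := vB _ _ _ _ sesk f.
  have injab : injective (pair_map a b).
    by apply: linear_inj => e [ae be]; exact: inj0.
  have [h hE] : exists h : {linear Q -> E}, forall q,
      pair_map a b (h q) = pair_map idfun (i \o p') q.
    apply: linear_lift => // q; have [|e ae be] := univ q (i (p' q)); first by rewrite ri.
    by exists e; rewrite /= /pair_map /= ae be.
  exists (g \o h) => x /=; rewrite -gE; congr (g _); apply: injab; rewrite hE.
  rewrite /= /pair_map /= ak (ses_sub0 _ sesip') linear0.
  by rewrite (ses_sub0 _ sesk).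
- move=> [K [Q [i' [p' [sesip' projQ vK]]]]].
  exists K, (Q * C)%type, (pair_map i' \0), (copair (i \o p') s); split=> //; last first.
    exact: projective_prod.
  have [inji' surjp' exip'] := sesip'; split=> [x y [/inji'//]|b|[q c]].
    have /exip[a ab] : p (b - s (p b)) = 0 by rewrite linearB sE subrr.
    have [q qa] := surjp' a; exists (q, p b).
    by rewrite /= /copair /= qa ab subrK.
  rewrite /= /copair /pair_map /=; split=> [qc|[k [<- <-]]]; last first.
    by rewrite (ses_sub0 _ sesip') !linear0 addr0.
  have c0 : c = 0.
    by move: (congr1 p qc); rewrite linearD linear0 sE (ses_sub0 _ sesip) add0r.
  move: qc; rewrite c0 linear0 addr0 => iq.
  have /exip'[k kq] : p' q = 0 by apply: inji; rewrite iq linear0.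
  by exists k; rewrite kq.
move=> [K [Q [i' [p' [sesip' projQ vK]]]]]; have [inji' surjp' exip'] := sesip'.
pose u := p \o p'; pose j' := kernel_incl u.
have surju c : exists q, u q = c.
  by have [b <-] := surjp c; have [q <-] := surjp' b; exists q.
have [t tE] := projective_section surju projC.
have [r rE] : exists r : {linear Q -> kernel u}, forall q, j' (r q) = (idfun \- (t \o u)) q.
  apply: linear_lift => [|q]; first exact: kernel_incl_inj.
  by apply/kernel_inclP; rewrite /= !linearB; move: (tE (u q)) => /= ->; rewrite subrr.
have rj x : r (j' x) = x.
  apply: (@kernel_incl_inj _ _ _ u); rewrite -/j' rE.
  have uj : u (j' x) = 0 by apply/kernel_inclP; exists x.
  by change (j' x - t (u (j' x)) = j' x); rewrite uj linear0 subr0.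
have [k kE] : exists k : {linear K -> kernel u}, forall x, j' (k x) = i' x.
  apply: linear_lift => [|x]; first exact: kernel_incl_inj.
  by apply/kernel_inclP; rewrite /= (ses_sub0 _ sesip') linear0.
have [v vE] : exists v : {linear kernel u -> A}, forall x, i (v x) = (p' \o j') x.
  by apply: linear_lift => // x; apply/exip/(kernel_inclP u); exists x.
exists K, (kernel u), k, v; split=> //; last exact: projective_retract rj projQ.
split=> [x y kxy|a|x].
- by apply: inji'; rewrite -!kE kxy.
- have [q qa] := surjp' (i a).
  have /kernel_inclP[z zq] : u q = 0 by rewrite /u /= qa (ses_sub0 _ sesip).
  exists z; apply: inji; rewrite vE; change (p' (j' z) = i a).
  by rewrite (zq : j' z = q).
split=> [vx|[z <-]]; last first.
  apply: inji; rewrite vE linear0; change (p' (j' (k z)) = 0).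
  by rewrite kE (ses_sub0 _ sesip').
have /exip'[z zx] : p' (j' x) = 0 by move: (vE x); rewrite vx linear0.
by exists z; apply: (@kernel_incl_inj _ _ _ u); exact: etrans (kE z) zx.
Qed.

(* Schanuel's lemma: the pullback of two covers is an extension of each of the
   projective modules by the kernel of the other cover. *)
Lemma ext_vanishes_syzygy j X K Q (i : {linear K -> Q}) (p : {linear Q -> X}) :
  ses i p -> projective Q -> ext_vanishes j.+1 X <-> ext_vanishes j K.
Proof.
move=> sesip projQ; split=> [|vK]; last by exists K, Q, i, p.
move=> [K' [Q' [i' [p' [sesip' projQ' vK']]]]].
have [E [a [b [pa univ inj0]]]] := pullback_exists p p'.
have [k sesk _] := pullback_ses sesip pa univ inj0.
have [||k' sesk' _] := @pullback_ses _ _ _ _ _ _ i' p' p b a sesip' (fun e => esym (pa e)).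
- by move=> x y /esym/univ[e ae be]; exists e.
- by move=> e be ae; exact: inj0.
apply/(ext_vanishes_add_projective _ sesk projQ').
exact/(ext_vanishes_add_projective _ sesk' projQ).
Qed.

Lemma ext_vanishes_mid j X Y Z (i : {linear X -> Y}) (p : {linear Y -> Z}) :
  ses i p -> ext_vanishes j X -> ext_vanishes j Z -> ext_vanishes j Y.
Proof.
elim: j X Y Z i p => [|j IHj] X Y Z i p sesip; first exact: (ext_vanishes0_ses sesip).
move=> [KX [QX [iX [pX [sesX projX vX]]]]] [KZ [QZ [iZ [pZ [sesZ projZ vZ]]]]].
have [[inji surjp exip] [_ surjX exX]] := (sesip, sesX).
have [[injX _ _] [injZ surjZ exZ]] := (sesX, sesZ).
have [l lE] := projZ _ _ p pZ surjp.
pose q := copair (i \o pX) l; pose jq := kernel_incl q.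
have surjq y : exists x, q x = y.
  have [z zE] := surjZ (p y).
  have /exip[x xE] : p (y - l z) = 0 by rewrite linearB lE zE subrr.
  have [x' x'E] := surjX x; exists (x', z).
  by rewrite /q /= /copair /= x'E xE subrK.
have sesq := kernel_ses surjq.
apply/(ext_vanishes_syzygy _ sesq); first exact: projective_prod.
have jqE e : i (pX (jq e).1) + l (jq e).2 = 0.
  by have /kernel_inclP : exists k, kernel_incl q k = jq e by exists e.
have [a aE] : exists a : {linear KX -> kernel q}, forall x, jq (a x) = pair_map iX \0 x.
  apply: linear_lift => [|x]; first exact: kernel_incl_inj.
  by apply/kernel_inclP; rewrite /= /copair /= (ses_sub0 _ sesX) !linear0 addr0.
have [b bE] : exists b : {linear kernel q -> KZ}, forall x, iZ (b x) = (snd \o jq) x.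
  apply: linear_lift => // x; apply/exZ; rewrite /= -lE.
  move: (congr1 p (jqE x)); rewrite linearD linear0 (ses_sub0 _ sesip) add0r.
  exact.
apply: (IHj _ _ _ a b) => //; split=> [x y axy|z|e].
- by move: (aE x) (aE y); rewrite axy => -> [/injX].
- have /exip[x xE] : p (l (iZ z)) = 0 by rewrite lE (ses_sub0 _ sesZ).
  have [x' x'E] := surjX x.
  have /kernel_inclP[e eE] : q (- x', iZ z) = 0.
    change (i (pX (- x')) + l (iZ z) = 0).
    by rewrite linearN linearN x'E xE addNr.
  by exists e; apply: injZ; rewrite bE; exact: (congr1 snd eE).
split=> [be|[x <-]].
  have e2 : (jq e).2 = 0 by move/esym: (bE e); rewrite be linear0.
  have /exX[x xE] : pX (jq e).1 = 0.
    by apply: inji; move: (jqE e); rewrite e2 !linear0 addr0.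
  exists x; apply: (@kernel_incl_inj _ _ _ q); rewrite -/jq aE /= /pair_map /= xE.
  by apply: injective_projections; rewrite //= e2.
by apply: injZ; rewrite bE linear0; exact: (congr1 snd (aE x)).
Qed.

(* Exactness of Ext^j(Y) -> Ext^j(X) -> Ext^(j+1)(Z), rotated: with a cover
   K -> Q -> Z, the pullback of Y and Q is an extension of Y by K and of Q by X. *)
Lemma ext_vanishes_left j X Y Z (i : {linear X -> Y}) (p : {linear Y -> Z}) :
  ses i p -> ext_vanishes j Y -> ext_vanishes j.+1 Z -> ext_vanishes j X.
Proof.
move=> sesip vY [K' [Q' [i' [p' [sesip' projQ' vK']]]]].
have [E [a [b [pa univ inj0]]]] := pullback_exists p p'.
have [k sesk _] := pullback_ses sesip pa univ inj0.
have [||k' sesk' _] := @pullback_ses _ _ _ _ _ _ i' p' p b a sesip' (fun e => esym (pa e)).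
- by move=> x y /esym/univ[e ae be]; exists e.
- by move=> e be ae; exact: inj0.
apply/(ext_vanishes_add_projective _ sesk projQ').
exact: ext_vanishes_mid sesk' vK' vY.
Qed.

Lemma ext_vanishes_iso j X Y (f : {linear X -> Y}) : bijective f ->
  ext_vanishes j X -> ext_vanishes j Y.
Proof.
move=> /ses_zeror sesf.
by move/(ext_vanishes_add_projective _ sesf (@zero_module_projective R)).
Qed.

Lemma ext_vanishes_projective j X : projective X -> ext_vanishes j X.
Proof.
elim: j X => [|j IHj] X projX; first exact: ext_vanishes0_projective.
have sesid : ses (kernel_incl (idfun : {linear X -> X})) idfun.
  by apply: kernel_ses => x; exists x.
apply/(ext_vanishes_syzygy _ sesid projX)/IHj/zero_projective => -[x /eqP]; apply.
apply: (@kernel_incl_inj _ X X idfun); rewrite linear0.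
by apply/(kernel_inclP (idfun : {linear X -> X})); exists x.
Qed.

Lemma ses_ffun M n : exists (i : {linear M -> {ffun 'I_n.+1 -> M}})
  (p : {linear {ffun 'I_n.+1 -> M} -> {ffun 'I_n -> M}}), ses i p.
Proof.
pose i (x : M) : {ffun 'I_n.+1 -> M} := [ffun k => if k == ord0 then x else 0].
pose p (v : {ffun 'I_n.+1 -> M}) : {ffun 'I_n -> M} := [ffun k => v (lift ord0 k)].
have i_lin : linear i.
  by move=> a x y; apply/ffunP => k; rewrite !ffunE; case: eqP; rewrite // scaler0 addr0.
have p_lin : linear p by move=> a x y; apply/ffunP => k; rewrite !ffunE.
pose iL : {linear M -> {ffun 'I_n.+1 -> M}} :=
  HB.pack i (GRing.isLinear.Build _ _ _ _ i i_lin).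
pose pL : {linear {ffun 'I_n.+1 -> M} -> {ffun 'I_n -> M}} :=
  HB.pack p (GRing.isLinear.Build _ _ _ _ p p_lin).
exists iL, pL; split=> /=.
- by move=> x y /ffunP/(_ ord0); rewrite !ffunE eqxx.
- move=> v; exists [ffun k => if unlift ord0 k is Some k' then v k' else 0].
  by apply/ffunP => k; rewrite !ffunE liftK.
move=> v; split=> [/ffunP pv|[x <-]]; last by apply/ffunP => k; rewrite !ffunE.
exists (v ord0); apply/ffunP => k; rewrite !ffunE.
have [->//|k0] := eqVneq; have [k' ->|k00] := unliftP ord0 k.
  by have := pv k'; rewrite !ffunE.
by rewrite k00 eqxx in k0.
Qed.

Lemma ext_vanishes_ffun j n M : ext_vanishes j M ->
  ext_vanishes j {ffun 'I_n -> M}.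
Proof.
move=> vM; elim: n => [|n IHn].
  apply: ext_vanishes_projective; apply: zero_projective => -[v /eqP]; apply.
  by apply/ffunP => -[].
by have [i [p sesip]] := ses_ffun M n; exact: ext_vanishes_mid sesip vM IHn.
Qed.

Lemma ext_vanishes_ffun_inv j n M : n != 0%N -> ext_vanishes j.+1 M ->
  ext_vanishes j {ffun 'I_n -> M} -> ext_vanishes j M.
Proof.
case: n => // n _ vM vMn; have [i [p sesip]] := ses_ffun M n.
by apply: ext_vanishes_left sesip vMn _; exact: ext_vanishes_ffun.
Qed.

End ExtVanishing.

Section ExtLink.
Variables (R : comNzRingType) (N : lmodType R).
Implicit Types (A B C E K M Q X Y Z : lmodType R).

Lemma extends_ext_vanishes X K Q (i : {linear K -> Q}) (p : {linear Q -> X}) :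
  ses i p -> projective Q -> extends N i -> ext_vanishes N 0 X.
Proof.
move=> sesip projQ exti K' Q' i' p' sesip' f.
have [[_ surjp exip] [inji' surjp' exip']] := (sesip, sesip').
have [h hE] := projQ _ _ p' p surjp'.
have [h' h'E] : exists h' : {linear K -> K'}, forall x, i' (h' x) = (h \o i) x.
  by apply: linear_lift => // x; apply/exip'; rewrite /= hE (ses_sub0 _ sesip).
have [g gE] := exti (f \o h').
have [g' g'E] : exists g' : {linear Q' -> N}, forall x,
    g' (copair h i' x) = copair g f x.
  apply: linear_factor => [q'|[q k]].
    have [q qE] := surjp (p' q').
    have /exip'[k kE] : p' (q' - h q) = 0 by rewrite linearB hE qE subrr.
    by exists (q, k); rewrite /= /copair /= kE addrC subrK.
  rewrite /= /copair /= => hqk.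
  have /exip[x xE] : p q = 0.
    by move: (congr1 p' hqk); rewrite linearD linear0 hE (ses_sub0 _ sesip') addr0.
  rewrite -xE gE /= -linearD -[RHS](linear0 f); congr (f _); apply: inji'.
  by rewrite linearD h'E /= xE hqk linear0.
exists g' => k; have := g'E (0, k).
by rewrite /= /copair /= !linear0 !add0r.
Qed.

Lemma cover_onto X (x : X) : exists y, Defs.cover X y = x.
Proof. by eexists; exact: free_liftU. Qed.

Lemma syzygy_ses X n :
  ses (kernel_incl (Defs.cover (syzygy X n)) : {linear syzygy X n.+1 -> _})
      (Defs.cover (syzygy X n)).
Proof. exact: kernel_ses (@cover_onto _). Qed.

Lemma ext_vanishes_iter_syzygy j n X :
  ext_vanishes N j (syzygy X n) <-> ext_vanishes N 0 (syzygy X (n + j)).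
Proof.
elim: j n => [|j IHj] n; first by rewrite addn0.
have [h1 h2] := IHj n.+1.
have [h3 h4] := ext_vanishes_syzygy N j (syzygy_ses X n) (@free_on_projective _ _).
by rewrite addnS -addSn; split=> [/h3/h1|/h2/h4].
Qed.

Lemma homology_zero A B C (g : {linear A -> B}) (f : {linear B -> C}) :
  ~ nonzero (homology g f) <-> forall z, f z = 0 -> exists y, g y = z.
Proof.
split=> [H0 z fz|]; last exact: homology_eq0.
have zK : z \in kernel_pred f by rewrite inE fz.
apply/(@homology_class_eq0 _ _ _ _ g f (Kernel zK)).
by apply/negPn/negP => nz; apply: H0; exists (homology_class g (Kernel zK)).
Qed.

Lemma ExtS_vanishes j X :
  ~ nonzero (Ext j.+1 X N) <-> ext_vanishes N j X.
Proof.
have [h1 h2] := ext_vanishes_iter_syzygy j 0 X.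
have ses_j := syzygy_ses X j; have projF := @free_on_projective R.
have ej : (j.+1 : int) - 1 = j by rewrite subzn ?subn1.
have ej2 : (j.+1 : int) + 1 = j.+2 by rewrite -PoszD addn1.
rewrite /Ext /Hlgy_Hom; rewrite homology_zero.
change (cx_diff (free_resolution X)) with (@res_map R X).
move: ej ej2; move: (_ - 1) (_ + 1) => k k2 -> ->; rewrite !res_mapS.
split=> [Ext0|vX].
  apply: h2; apply: (extends_ext_vanishes ses_j) => // f.
  have [|g gE] := Ext0 (f \o Defs.cover (syzygy X j.+1)).
    apply: hom_ext => y /=.
    by case: (Defs.cover _ y) => z /= /eqP ->; rewrite linear0.
  exists (hom_fun g) => x; have [y <-] := cover_onto x.
  exact: (congr1 (fun h => hom_fun h y) gE).
move=> f fd.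
have [f' f'E] : exists f' : {linear syzygy X j.+1 -> N},
    forall y, f' (Defs.cover _ y) = hom_fun f y.
  apply: linear_factor => [|y y0]; first exact: cover_onto.
  have [z <-] : exists z, res_diff X j.+1 z = y.
    apply: res_diff_eq0.
    change (kernel_incl (Defs.cover (syzygy X j)) (Defs.cover (syzygy X j.+1) y) = 0).
    by rewrite y0 linear0.
  exact: (congr1 (fun h => hom_fun h z) fd).
have [g gE] := h1 vX _ _ _ _ ses_j f'.
exists g; apply: hom_ext => y.
by rewrite -f'E -gE.
Qed.

Lemma Ext0_vanishes X : ~ nonzero (Ext 0 X N) ->
  forall (f : {linear X -> N}) x, f x = 0.
Proof.
rewrite /Ext /Hlgy_Hom homology_zero.
change (cx_diff (free_resolution X)) with (@res_map R X).
have e1 : (0 : int) + 1 = 1%N by [].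
move: e1; move: (_ + 1) => k -> Ext0 f x.
have [y <-] := cover_onto x; have [|g gE] := Ext0 (f \o Defs.cover X).
  rewrite res_mapS; apply: hom_ext => z /=.
  by case: (Defs.cover _ z) => z' /= /eqP ->; rewrite linear0.
have := congr1 (fun h => hom_fun h y) gE.
rewrite /= => <-; rewrite -(linear0 (hom_fun g)).
by congr (hom_fun g _); apply/matrixP => ? [].
Qed.

End ExtLink.

(** * Homology of quasi-projective resolutions *)

Section QuasiProjective.
Variable R : comNzRingType.
Implicit Types (A B C D E K M N Q V W X Y Z : lmodType R) (P : complex R).

Definition has_homology P (i k l : int) W : Prop :=
  exists e : {linear kernel (cx_diff P k l) -> W},
    (forall w, exists z, e z = w) /\
    forall z, e z = 0 <-> exists y, cx_diff P i k y = kernel_incl _ z.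

Lemma isomorphic_homology A B C W (g : {linear A -> B}) (f : {linear B -> C}) :
  isomorphic (homology g f) W <->
  exists e : {linear kernel f -> W}, (forall w, exists z, e z = w) /\
    forall z, e z = 0 <-> exists y, g y = kernel_incl f z.
Proof.
split=> [[h [h' hK h'K]]|[e [surje kere]]].
  exists (h \o @homology_class _ _ _ _ g f); split=> [w|z].
    exists (repr (h' w)) => /=.
    by change (h (homology_class g (repr (h' w))) = w); rewrite homology_classK h'K.
  have [c1 c2] := homology_class_eq0 g z; split=> [hz|/c2/eqP /= ->]; last exact: linear0.
  by apply/c1/eqP; apply: (can_inj hK); rewrite linear0.
have [h hE] : exists h : {linear homology g f -> W},
    forall z, h (homology_class g z) = e z.
  apply: linear_factor => [c|z /eqP/homology_class_eq0/kere//].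
  by elim/homology_ind: c => z; exists z.
exists h.
have injh : injective h.
  apply: linear_inj; elim/homology_ind => z; rewrite hE => /kere/homology_class_eq0.
  by move/eqP.
have surjh w : exists c, h c = w.
  by have [z <-] := surje w; exists (homology_class g z).
exists (fun w => sval (cid (surjh w))) => x; last by case: cid.
by apply: injh; case: cid.
Qed.

Lemma has_homologyP P i k l W : i = k + 1 -> l = k - 1 ->
  isomorphic (Hlgy P k) W <-> has_homology P i k l W.
Proof. by move=> -> ->; exact: isomorphic_homology. Qed.

Definition is_coker A B C (g : {linear A -> B}) (q : {linear B -> C}) : Prop :=
  (forall c, exists b, q b = c) /\ forall b, q b = 0 <-> exists a, g a = b.

Definition is_image A B C (g : {linear A -> B})
    (e : {linear A -> C}) (j : {linear C -> B}) : Prop :=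
  [/\ forall c, exists a, e a = c, injective j & forall a, j (e a) = g a].

Lemma coker_ses A B C D (g : {linear A -> B}) (q : {linear B -> D})
    (e : {linear A -> C}) (j : {linear C -> B}) :
  is_coker g q -> is_image g e j -> ses j q.
Proof.
move=> [surjq kerq] [surje injj jE]; split=> // b; split=> [/kerq[a <-]|[c <-]].
  by exists (e a).
by have [a <-] := surje c; apply/kerq; exists a.
Qed.

Lemma homology_ses P i k l W C B (q : {linear P k -> C})
    (e : {linear P k -> B}) (j : {linear B -> P l}) :
  has_homology P i k l W -> is_coker (cx_diff P i k) q ->
  is_image (cx_diff P k l) e j ->
  exists (s : {linear W -> C}) (t : {linear C -> B}), ses s t.
Proof.
move=> [h [surjh kerh]] [surjq kerq] [surje injj jE].
have [s sE] : exists s : {linear W -> C},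
    forall z, s (h z) = q (kernel_incl (cx_diff P k l) z).
  by apply: (@linear_factor _ _ _ _ h (q \o kernel_incl _)) => // z /kerh/kerq.
have [t tE] : exists t : {linear C -> B}, forall x, t (q x) = e x.
  apply: linear_factor => // x /kerq[y <-]; apply: injj.
  by rewrite jE cx_diff_diff linear0.
exists s, t; split=> [|b|c].
- apply: linear_inj => w; have [z <-] := surjh w; rewrite sE => /kerq qz.
  exact/kerh.
- by have [x <-] := surje b; exists (q x).
have [x <-] := surjq c; rewrite tE; split=> [ex|[w]].
  have /kernel_inclP[z zE] : cx_diff P k l x = 0 by rewrite -jE ex linear0.
  by exists (h z); rewrite sE zE.
have [z <-] := surjh w; rewrite sE -tE => <-; rewrite tE; apply: injj.
by rewrite jE linear0; apply/kernel_inclP; exists z.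
Qed.

Lemma zero_module_ffun M : ~ nonzero {ffun 'I_0 -> M}.
Proof. by move=> [v /eqP]; apply; apply/ffunP => -[]. Qed.

(* Here top is only an upper bound of sup P, so that it can be lowered without
   changing P. *)
Record resolution_data M P (a : int -> nat) (top h : int) : Prop := {
  rd_fg : forall i, finitely_generated (P i);
  rd_projective : forall i, projective (P i);
  rd_low : exists l : int, forall i, i < l -> ~ nonzero (P i);
  rd_homology : forall i, isomorphic (Hlgy P i) {ffun 'I_(a i) -> M};
  rd_hsup : a h != 0%N;
  rd_hsup_max : forall i, h < i -> a i = 0%N;
  rd_top : forall i, top < i -> ~ nonzero (P i) }.

Lemma zero_eq V : ~ nonzero V -> forall v : V, v = 0.
Proof. by move=> V0 v; apply: contrapT => /eqP nv; apply: V0; exists v. Qed.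

Section Vanishing.
Variables (M N : lmodType R) (P : complex R) (a : int -> nat) (top h : int).
Hypothesis rdP : resolution_data M P a top h.
Notation d := (cx_diff P).

Definition image_vanishes i k j := forall B (e : {linear P i -> B})
  (f : {linear B -> P k}), is_image (d i k) e f -> ext_vanishes N j B.

Definition coker_vanishes i k j := forall C (q : {linear P k -> C}),
  is_coker (d i k) q -> ext_vanishes N j C.

Lemma image_vanishes_coker i k j :
  coker_vanishes i k j.+1 -> image_vanishes i k j.
Proof.
move=> vC B e f imf; have [C [q cokq]] := coker_exists (d i k).
apply: (ext_vanishes_left (coker_ses cokq imf)) (vC _ _ cokq).
by apply: ext_vanishes_projective; exact: rd_projective rdP _.
Qed.

Lemma coker_vanishes_image i k j :
  image_vanishes i k j -> coker_vanishes i k j.+1.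
Proof.
move=> vB C q cokq; have [B [e [f imf]]] := image_exists (d i k).
exists B, (P k), f, q; split; last exact: vB imf.
  exact: coker_ses cokq imf.
exact: rd_projective rdP _.
Qed.

Lemma coker_vanishes_homology i k l j : i = k + 1 -> l = k - 1 ->
  ext_vanishes N j {ffun 'I_(a k) -> M} ->
  image_vanishes k l j -> coker_vanishes i k j.
Proof.
move=> ik lk vM vB C q cokq; have [B [e [f imf]]] := image_exists (d k l).
have /(has_homologyP _ _ ik lk) homk := rd_homology rdP k.
have [s [t sesst]] := homology_ses homk cokq imf.
by apply: (ext_vanishes_mid sesst) => //; exact: vB imf.
Qed.

Lemma image_vanishes_above i k l j : i = k + 1 -> l = k - 1 -> h < k ->
  coker_vanishes i k j -> image_vanishes k l j.
Proof.
move=> ik lk hk vC B e f imf; have [C [q cokq]] := coker_exists (d i k).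
have /(has_homologyP _ _ ik lk) homk := rd_homology rdP k.
have [s [t [_ surjt ext]]] := homology_ses homk cokq imf.
apply: (ext_vanishes_iso (f := t)) (vC _ _ cokq).
have injt : injective t.
  apply: linear_inj => c /ext[w <-]; rewrite (_ : w = 0) ?linear0 //.
  by move: w; rewrite (rd_hsup_max rdP hk); exact: zero_eq (@zero_module_ffun M).
exists (fun b => sval (cid (surjt b))) => x; last by case: cid.
by apply: injt; case: cid.
Qed.

Lemma vanishes_everywhere q0 : (forall j, (q0 <= j)%N -> ext_vanishes N j M) ->
  forall k j, (q0 <= j)%N ->
    image_vanishes k (k - 1) j /\ coker_vanishes (k + 1) k j.
Proof.
move=> vM; have [l lP] := rd_low rdP.
have step k : (forall j, (q0 <= j)%N -> image_vanishes k (k - 1) j) ->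
    forall j, (q0 <= j)%N -> coker_vanishes (k + 1) k j.
  move=> vB j q0j; apply: (@coker_vanishes_homology _ _ (k - 1)) => //.
    by apply: ext_vanishes_ffun; exact: vM.
  exact: vB.
have vlow k : k < l -> forall j, (q0 <= j)%N -> image_vanishes k (k - 1) j.
  move=> kl j _ B e f [surje _ _].
  apply: ext_vanishes_projective; apply: zero_projective => -[b /eqP]; apply.
  by have [x <-] := surje b; rewrite (zero_eq (lP k kl) x) linear0.
have vup (n : nat) k : k = l + n%:Z -> forall j, (q0 <= j)%N -> image_vanishes k (k - 1) j.
  elim: n k => [|n IHn] k ek j q0j.
    apply: (@image_vanishes_coker k (k - 1) j).
    have := @step (k - 1); rewrite subrK; apply; last exact: leqW.
    by apply: vlow; rewrite ek addr0 ltrBlDr ltrDl.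
  apply: (@image_vanishes_coker k (k - 1) j).
  have := @step (k - 1); rewrite subrK; apply; last exact: leqW.
  by apply: IHn; rewrite ek -addn1 PoszD addrA addrK.
move=> k j q0j; suff vB : forall j, (q0 <= j)%N -> image_vanishes k (k - 1) j.
  by split; [exact: vB|exact: step].
have [kl|lk] := ltP k l; first exact: vlow.
by apply: (vup `|k - l|%N); rewrite gez0_abs ?subr_ge0 // addrCA subrr addr0.
Qed.

Lemma ext_vanishes_below j (n : nat) : top = h + n%:Z -> (n <= j)%N ->
  (forall j', (j < j')%N -> ext_vanishes N j' M) -> ext_vanishes N j M.
Proof.
move=> etop nj vM.
have vC (t : nat) k : (t <= n)%N -> top = k + t%:Z ->
    coker_vanishes (k + 1) k (t + (j - n)).
  elim: t k => [|t IHt] k tn ek.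
    move=> C q [surjq kerq]; apply: (ext_vanishes_iso (f := q)).
      have injq : injective q.
        apply: linear_inj => x /kerq[y <-]; rewrite (_ : y = 0) ?linear0 //.
        apply: zero_eq; apply: (rd_top rdP); rewrite ek addr0 ltrDl; exact: ltr01.
      exists (fun b => sval (cid (surjq b))) => x; last by case: cid.
      by apply: injq; case: cid.
    by apply: ext_vanishes_projective; exact: rd_projective rdP _.
  rewrite addSn; apply: coker_vanishes_image.
  apply: (@image_vanishes_above (k + 1 + 1)) => //; first by rewrite addrK.
    have : h + n%:Z = k + t.+1%:Z by rewrite -ek.
    lia.
  apply: IHt; first exact: ltnW.
  by rewrite ek -add1n PoszD addrA.
have {}vC : coker_vanishes (h + 1) h j by rewrite -(subnKC nj); exact: vC.
have vB : image_vanishes h (h - 1) j.+1.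
  by have [] := @vanishes_everywhere j.+1 vM h j.+1 (leqnn _).
have [C [q cokq]] := coker_exists (d (h + 1) h).
have [B [e [f imf]]] := image_exists (d h (h - 1)).
have /(has_homologyP (k := h) _ _ erefl erefl) homh := rd_homology rdP h.
have [s [t sesst]] := homology_ses homh cokq imf.
apply: (ext_vanishes_ffun_inv (rd_hsup rdP)); first exact: vM.
exact: ext_vanishes_left sesst (vC _ _ cokq) (vB _ _ _ imf).
Qed.

Lemma extends_top j (n : nat) : top = h + n.+1%:Z -> (j <= n)%N ->
  (forall j', (j <= j')%N -> ext_vanishes N j' M) -> extends N (d top (top - 1)).
Proof.
move=> etop jn vM.
have vC (t : nat) k : (t <= n)%N -> k = h + t%:Z -> coker_vanishes (k + 1) k (n - t).
  elim: t k => [|t IHt] k tn ek.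
    by rewrite subn0; case: (vanishes_everywhere vM k jn).
  apply: (@coker_vanishes_homology _ _ (k - 1)) => //.
    rewrite (rd_hsup_max rdP); last by rewrite ek ltrDl.
    exact/ext_vanishes_projective/zero_projective/zero_module_ffun.
  apply: image_vanishes_coker; rewrite subnSK // -[X in coker_vanishes X](subrK 1 k).
  by apply: IHt; [exact: ltnW|rewrite ek -addn1 PoszD addrA addrK].
have {}vC : coker_vanishes top (top - 1) 0.
  have := @vC n (top - 1) (leqnn n); rewrite subnn subrK; apply.
  by rewrite etop -addn1 PoszD addrA addrK.
have [C [q cokq]] := coker_exists (d top (top - 1)).
apply: (vC _ _ cokq) => //; case: cokq => surjq kerq; split=> //.
apply: linear_inj => x dx.
have /(has_homologyP (k := top) _ _ erefl erefl)[e [_ kere]] := rd_homology rdP top.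
have /kernel_inclP[z zx] := dx.
have /kere[y] : e z = 0.
  move: (e z); rewrite (rd_hsup_max rdP); last by rewrite etop ltrDl.
  exact: zero_eq (@zero_module_ffun M).
rewrite zx => <-; rewrite (_ : y = 0) ?linear0 //.
by apply: zero_eq; apply: (rd_top rdP); rewrite ltrDl.
Qed.

Lemma extends_top_hsup : top = h -> (forall j, ext_vanishes N j M) ->
  (forall (f : {linear M -> N}) x, f x = 0) -> extends N (d top (top - 1)).
Proof.
move=> etop vM hom0 f.
have /(has_homologyP (k := top) _ _ erefl erefl)[e [surje kere]] := rd_homology rdP top.
have [C [q cokq]] := coker_exists (d top (top - 1)).
have [B [eB [fB imB]]] := image_exists (d top (top - 1)).
have hom_ffun0 n (g : {linear {ffun 'I_n -> M} -> N}) v : g v = 0.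
  elim: n g v => [|n IHn] g v; first by rewrite (zero_eq (@zero_module_ffun M) v) linear0.
  have [i [p [inji surjp exip]]] := ses_ffun M n.
  have [g' g'E] : exists g' : {linear {ffun 'I_n -> M} -> N}, forall v, g' (p v) = g v.
    apply: linear_factor => // w /exip[x <-]; exact: (hom0 (g \o i)).
  by rewrite -g'E IHn.
have [g gE] : exists g : {linear {ffun 'I_(a top) -> M} -> N},
    forall z, g (e z) = f (kernel_incl _ z).
  apply: (@linear_factor _ _ _ _ e (f \o kernel_incl _)) => // z /kere[y].
  rewrite (_ : y = 0) => [|]; first by rewrite linear0 /= => <-; exact: linear0.
  by apply: zero_eq; apply: (rd_top rdP); rewrite ltrDl.
have [f' f'E] : exists f' : {linear B -> N}, forall x, f' (eB x) = f x.
  case: imB => surjeB _ fBE; apply: linear_factor => // x ex.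
  have /kernel_inclP[z <-] : d top (top - 1) x = 0 by rewrite -fBE ex linear0.
  by rewrite -gE hom_ffun0.
have vC : coker_vanishes top (top - 1) 0.
  have [_] := @vanishes_everywhere 0 (fun j _ => vM j) (top - 1) 0 isT.
  by rewrite subrK.
have [g' g'E] := vC _ _ cokq _ _ _ _ (coker_ses cokq imB) f'.
by exists g' => x; case: imB => _ _ <-; rewrite g'E f'E.
Qed.

End Vanishing.
End QuasiProjective.

(** * Minimal resolutions *)

Section Minimality.
Variables (R : comNzRingType) (m : set R).
Hypotheses (noethR : noetherian R) (localR : local_ring m).
Implicit Types (V W M N : lmodType R) (P : complex R).

Lemma lspan_remove V (l : seq V) u : lspan l u -> ~ maximal_multiple m u ->
  exists2 l' : seq V, (size l' < size l)%N &
    forall x, lspan l x -> exists a, lspan l' (x - a *: u).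
Proof.
elim: l u => [|g l IHl] u /=.
  by move=> -> []; exists [::].
move=> [c uc] nu; have [mc|nmc] := pselect (m c); last first.
  have [b bc] := local_unit noethR localR nmc; have sl := lspan_submodule l.
  exists l => // x [a xa]; exists (a * b).
  have -> : x - (a * b) *: u = (x - a *: g) - (a * b) *: (u - c *: g).
    have -> : a *: g = (a * b) *: (c *: g) by rewrite scalerA -mulrA bc mulr1.
    by zmod_solve.
  by apply: submoduleB => //; exact: submoduleZ.
have [|l' sl' ll'] := IHl _ uc.
  move=> mu; apply: nu; rewrite -(subrK (c *: g) u).
  apply: submoduleD => //; first exact: maximal_multiple_submodule.
  exact: maximal_multipleZ.
exists (g :: l') => // x [b /ll'[a xa]]; exists a; exists (b - a * c).
have -> : x - a *: u - (b - a * c) *: g = x - b *: g - a *: (u - c *: g).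
  by zmod_solve.
exact: xa.
Qed.

Lemma image_lspan V W (p : {linear V -> W}) (g : {linear V -> R^o}) u (l : seq V) :
  (forall w, exists v, p v = w) -> p u = 0 -> g u = 1 -> (forall v, lspan l v) ->
  exists2 l' : seq W, (size l' < size l)%N & forall w, lspan l' w.
Proof.
move=> surjp pu gu lV; have [|l' sl' ll'] := @lspan_remove V l u (lV u).
  move=> /(maximal_multiple_map g)/(maximal_multiple_ring localR).
  by rewrite gu; exact: local_proper.
exists (map p l'); first by rewrite size_map.
move=> w; have [v <-] := surjp w; have [a va] := ll' v (lV v).
have <- : p (v - a *: u) = p v by rewrite linearB linearZ /= pu scaler0 subr0.
apply: (lspan_sub (submodule_preim p (lspan_submodule _)) _ va) => x xl' /=.
by apply: mem_lspan; exact: map_f.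
Qed.

Lemma linear_sub2Z V W (f : {linear V -> W}) x b y c z :
  f (x - b *: y - c *: z) = f x - b *: f y - c *: f z.
Proof. by rewrite !linearB !linearZ. Qed.

Section Reduction.
Variables (M : lmodType R) (P : complex R) (a : int -> nat) (top h : int).
Hypothesis rdP : resolution_data M P a top h.
Notation d := (cx_diff P).
Variables (g : {linear P (top - 1) -> R^o}) (u : P top).
Hypothesis gu : g (d top (top - 1) u) = 1.

(* Extending g and u by zero to all degrees, let sigma x := g x *: u, of degree 1.
   Then e := d sigma + sigma d is idempotent, and its kernel is the subcomplex on
   which g and g d vanish; it has the homology of P since e is null-homotopic.
   Below, ret = 1 - e, and rho is its corestriction to that subcomplex. *)
Let gg : forall i, {linear P i -> R^o} :=
  dfwith (fun i => \0 : {linear P i -> R^o}) g.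
Let vv : forall i, P i := dfwith (fun i => 0 : P i) u.

Let gg_vv i : gg i (vv i) = 0.
Proof.
rewrite /vv; have [<-|ti] := eqVneq top i; last by rewrite dfwith_out // linear0.
by rewrite /gg dfwith_out // lt_eqF // ltrBlDr ltrDl.
Qed.

Let gg_d_vv i k x : k = i + 1 -> gg i x *: gg i (d k i (vv k)) = gg i x.
Proof.
rewrite /gg; have [ti|ti] := eqVneq (top - 1) i; last by rewrite dfwith_out // scale0r.
move: x; rewrite -ti subrK => x ->; rewrite /vv !dfwith_in.
by rewrite gu [_ *: _]mulr1.
Qed.

Let test i : {linear P i -> (R^o * R^o)%type} :=
  pair_map (gg i) (gg (i - 1) \o d i (i - 1)).
Let ob i : lmodType R := kernel (test i).
Let incl {i} : {linear ob i -> P i} := kernel_incl (test i).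

Let incl_gg i (x : ob i) : gg i (incl x) = 0.
Proof.
by have /kernel_inclP[] : exists y, kernel_incl (test i) y = incl x by exists x.
Qed.

Let incl_gg_d i j (x : ob i) : gg j (d i j (incl x)) = 0.
Proof.
have [ij|/cx_diff_shape->] := eqVneq i (j + 1); last exact: linear0.
have -> : j = i - 1 by rewrite ij addrK.
by have /kernel_inclP[] : exists y, kernel_incl (test i) y = incl x by exists x.
Qed.

Let diff_exists i j :
  exists f : {linear ob i -> ob j}, forall x, incl (f x) = d i j (incl x).
Proof.
have [|x|f fE] := @linear_lift _ _ _ _ (@incl j) (d i j \o @incl i).
- exact: kernel_incl_inj.
- apply/kernel_inclP.
  change ((gg j (d i j (incl x)), gg (j - 1) (d j (j - 1) (d i j (incl x)))) = 0).
  by rewrite incl_gg_d cx_diff_diff linear0.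
by exists f.
Qed.

Let diff i j := sval (cid (diff_exists i j)).
Let diffE i j x : incl (diff i j x) = d i j (incl x).
Proof. by rewrite /diff; case: cid. Qed.

Let incl_inj i : injective (@incl i).
Proof. exact: kernel_incl_inj. Qed.

Let diff_shape i j : i != j + 1 -> forall x, diff i j x = 0.
Proof.
by move=> ij x; apply: incl_inj; rewrite diffE linear0 cx_diff_shape.
Qed.

Let diff_diff i j k x : diff j k (diff i j x) = 0.
Proof. by apply: incl_inj; rewrite !diffE cx_diff_diff linear0. Qed.

Let P' := Complex diff_shape diff_diff.

Let ret i : {linear P i -> P i} :=
  idfun \- (scale_at (d (i + 1) i (vv (i + 1))) \o gg i)
        \- (scale_at (vv i) \o (gg (i - 1) \o d i (i - 1))).

Let retE i x : ret i x =
  x - gg i x *: d (i + 1) i (vv (i + 1)) - gg (i - 1) (d i (i - 1) x) *: vv i.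
Proof. by []. Qed.

Let rho_exists i :
  exists f : {linear P i -> ob i}, forall x, incl (f x) = ret i x.
Proof.
apply: linear_lift => [|x]; first exact: kernel_incl_inj.
apply/kernel_inclP; rewrite /test.
change ((gg i (ret i x), gg (i - 1) (d i (i - 1) (ret i x))) = 0).
have -> : gg i (ret i x) = 0.
  by rewrite retE linear_sub2Z gg_vv scaler0 subr0 gg_d_vv // subrr.
rewrite retE !linear_sub2Z cx_diff_diff linear0 scaler0 subr0.
by rewrite (@gg_d_vv (i - 1) i) ?subrK // subrr.
Qed.

Let rho i := sval (cid (rho_exists i)).
Let rhoE i x : incl (rho i x) = ret i x.
Proof. by rewrite /rho; case: cid. Qed.

Let rhoK i x : rho i (incl x) = x.
Proof.
by apply: incl_inj; rewrite rhoE retE incl_gg incl_gg_d !scale0r !subr0.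
Qed.

Let d_ret i j x : d i j (ret i x) = d i j x - gg (i - 1) (d i (i - 1) x) *: d i j (vv i).
Proof.
by rewrite retE linear_sub2Z cx_diff_diff scaler0 subr0.
Qed.

Let has_homology_reduction i W :
  has_homology P (i + 1) i (i - 1) W -> has_homology P' (i + 1) i (i - 1) W.
Proof.
move=> [e [surje kere]].
have [k kE] : exists k : {linear kernel (diff i (i - 1)) -> kernel (d i (i - 1))},
    forall z, kernel_incl _ (k z) = incl (kernel_incl _ z).
  apply: (@linear_lift _ _ _ _ _ (@incl i \o kernel_incl _)) => [|z].
    exact: kernel_incl_inj.
  apply/kernel_inclP => /=; rewrite -diffE -[RHS](linear0 (@incl (i - 1))).
  by congr (incl _); apply/kernel_inclP; exists z.
exists (e \o k); split=> [w|z].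
  have [z <-] := surje w; set x := kernel_incl _ z.
  have dx : d i (i - 1) x = 0 by apply/kernel_inclP; exists z.
  have /kernel_inclP[z' z'E] : diff i (i - 1) (rho i x) = 0.
    by apply: incl_inj; rewrite diffE rhoE d_ret dx linear0 linear0 scale0r subr0.
  exists z'; apply/eqP; rewrite /= -subr_eq0 -linearB; apply/eqP/kere.
  exists (- (gg i x *: vv (i + 1))).
  rewrite linearB kE z'E rhoE retE dx linear0 scale0r subr0 linearN linearZ /=.
  by rewrite addrAC subrr sub0r.
split=> [/kere[y yE]|[y yE]]; last first.
  by apply/kere; exists (incl y); rewrite kE -yE diffE.
exists (rho _ y); apply: incl_inj.
change (incl (diff (i + 1) i (rho (i + 1) y)) = incl (kernel_incl (diff i (i - 1)) z)).
rewrite diffE rhoE d_ret -kE yE.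
have -> : gg (i + 1 - 1) (d (i + 1) (i + 1 - 1) y) = 0.
  by move: (i + 1 - 1) (addrK 1 i) => j ->; rewrite yE kE incl_gg.
by rewrite scale0r subr0.
Qed.

Lemma resolution_reduction : exists2 Q : complex R, resolution_data M Q a top h &
  forall l : seq (P top), (forall x, lspan l x) ->
    exists2 l' : seq (Q top), (size l' < size l)%N & forall x, lspan l' x.
Proof.
have zero_ob i : ~ nonzero (P i) -> ~ nonzero (P' i).
  move=> P0 [x /eqP]; apply; apply: incl_inj; rewrite linear0.
  exact: zero_eq.
have surj_rho i y : exists x, rho i x = y by exists (incl y); exact: rhoK.
exists P'; last first.
  move=> l lP; apply: (@image_lspan _ _ (rho top) (g \o d top (top - 1)) u) => //.
  have vvE : vv top = u by rewrite /vv dfwith_in.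
  have gg0 : gg top u = 0 by rewrite -vvE gg_vv.
  have gg1 : gg (top - 1) (d top (top - 1) u) = 1 by rewrite /gg dfwith_in.
  apply: incl_inj; rewrite rhoE retE gg0 gg1 scale0r subr0 scale1r vvE subrr.
  by rewrite linear0.
split.
- by move=> i; apply: (fg_image (surj_rho i)); exact: rd_fg rdP _.
- by move=> i; apply: (projective_retract (@rhoK i)); exact: rd_projective rdP _.
- by have [l lP] := rd_low rdP; exists l => i /lP/zero_ob.
- move=> i; apply/(@has_homologyP _ P' (i + 1) i (i - 1)) => //.
  by apply: has_homology_reduction; apply/has_homologyP => //; exact: rd_homology rdP _.
- exact: rd_hsup rdP.
- exact: rd_hsup_max rdP.
- by move=> i /(rd_top rdP)/zero_ob.
Qed.

End Reduction.

Lemma minimum_nat (Q : nat -> Prop) :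
  (exists n, Q n) -> exists2 n, Q n & forall k, Q k -> (n <= k)%N.
Proof.
move=> [n Qn]; have exQ : exists n, `[< Q n >] by exists n; apply/asboolP.
have [k /asboolP Qk kmin] := ex_minnP exQ.
by exists k => // j Qj; apply: kmin; apply/asboolP.
Qed.

Lemma resolution_hsup_nonzero M P a top h : nonzero M ->
  resolution_data M P a top h -> nonzero (P h).
Proof.
move=> [x nx] rdP; apply: contrapT => P0.
have /(has_homologyP (k := h) _ _ erefl erefl)[e [surje _]] := rd_homology rdP h.
case: (a h) (rd_hsup rdP) e surje => // n _ e surje.
have [z] := surje [ffun=> x]; rewrite (_ : z = 0) ?linear0 => [/ffunP/(_ ord0)|].
  by rewrite !ffunE => x0; rewrite -x0 eqxx in nx.
by apply: kernel_incl_inj; rewrite linear0; exact: zero_eq.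
Qed.

Lemma resolution_hsup_le_top M P a top h : nonzero M ->
  resolution_data M P a top h -> h <= top.
Proof.
move=> M0 rdP; rewrite leNgt; apply/negP => /(rd_top rdP); apply.
exact: resolution_hsup_nonzero rdP.
Qed.

Lemma resolution_minimal M : nonzero M ->
  (exists P a top h, resolution_data M P a top h) ->
  exists P a top h, [/\ resolution_data M P a top h,
    forall P' a' top' h', resolution_data M P' a' top' h' -> top - h <= top' - h',
    nonzero (P top) &
    forall (g : {linear P (top - 1) -> R^o}) u, m (g (cx_diff P top (top - 1) u))].
Proof.
move=> M0 [P0 [a0 [top0 [h0 rd0]]]].
have subn_h P a top h : resolution_data M P a top h -> top - h = `|top - h|%N :> int.
  by move=> /(resolution_hsup_le_top M0); lia.
have [|n [P1 [a1 [top1 [h1 [rd1 n1]]]]] nmin] := @minimum_nat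
    (fun n => exists P a top h, resolution_data M P a top h /\ top - h = n%:Z).
  by exists `|top0 - h0|%N, P0, a0, top0, h0; split=> //; exact: subn_h rd0.
have [l1 l1P] : exists l : seq (P1 top1), forall x, lspan l x.
  exact/finitely_generatedE/(rd_fg rd1).
have [|k [P [a [top [h [rdP nP [l lP <-]]]]]] kmin] := @minimum_nat
    (fun k => exists P a top h, [/\ resolution_data M P a top h, top - h = n%:Z &
       exists2 l : seq (P top), forall x, lspan l x & size l = k]).
  by exists (size l1), P1, a1, top1, h1; split=> //; exists l1.
have minP P' a' top' h' : resolution_data M P' a' top' h' -> top - h <= top' - h'.
  move=> rd'; rewrite nP (subn_h _ _ _ _ rd') lez_nat; apply: nmin.
  by exists P', a', top', h'; split=> //; exact: subn_h rd'.
exists P, a, top, h; split=> //.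
  apply: contrapT => Ptop0.
  have /minP : resolution_data M P a (top - 1) h.
    case: rdP => fg pr low hom hs hsm tp; split=> // i; rewrite ltrBlDr ltzD1 le_eqVlt.
    by case/predU1P => [<-//|/tp].
  by lia.
move=> g u; apply: contrapT => /(local_unit noethR localR)[b bE].
have [|Q rdQ genQ] := @resolution_reduction M P a top h rdP (b \*: g) u.
  exact: bE.
have [l' sl' l'Q] := genQ l lP.
have : (size l <= size l')%N by apply: kmin; exists Q, a, top, h; split=> //; exists l'.
by rewrite leqNgt sl'.
Qed.

Lemma dual_basis V : finitely_generated V -> projective V ->
  exists n (f : 'I_n -> {linear V -> R^o}) (e : 'I_n -> V),
    forall x, x = \sum_(k < n) f k x *: e k.
Proof.
move=> [n [g gV]] projV.
pose p (c : {ffun 'I_n -> R^o}) : V := \sum_(k < n) (c k : R) *: g k.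
have p_lin : linear p.
  move=> a x y; rewrite /p scaler_sumr -big_split /=; apply: eq_bigr => k _.
  by rewrite !ffunE scalerDl scalerA.
pose pL : {linear {ffun 'I_n -> R^o} -> V} :=
  HB.pack p (GRing.isLinear.Build _ _ _ _ p p_lin).
have [|s sE] := projective_section (p := pL) _ projV.
  move=> x; have [c ->] := gV x; exists [ffun k => c k].
  by rewrite /pL /= /p; apply: eq_bigr => k _; rewrite ffunE.
have pr_lin k : linear (fun c : {ffun 'I_n -> R^o} => c k).
  by move=> a x y; rewrite !ffunE.
pose pr k : {linear {ffun 'I_n -> R^o} -> R^o} :=
  HB.pack (fun c : {ffun 'I_n -> R^o} => c k)
    (GRing.isLinear.Build _ _ _ _ (fun c : {ffun 'I_n -> R^o} => c k) (pr_lin k)).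
by exists n, (fun k => pr k \o s), g => x; rewrite -[LHS]sE.
Qed.

Lemma dual_unit V (u : V) : finitely_generated V -> projective V ->
  ~ maximal_multiple m u -> exists f : {linear V -> R^o}, f u = 1.
Proof.
move=> fgV projV nu; have [n [f [e fE]]] := dual_basis fgV projV.
have [k nmk] : exists k, ~ m (f k u).
  apply: contrapT => no; apply: nu; rewrite [u]fE.
  elim/big_ind: _ => [|x y|k _].
  - exact: submodule0 (maximal_multiple_submodule m V).
  - exact: submoduleD (maximal_multiple_submodule m V).
  by apply: maximal_multipleZ; apply: contrapT => nk; apply: no; exists k.
have [b bE] := local_unit noethR localR nmk.
by exists (b \*: f k).
Qed.

Lemma minimal_top_differential P top :
  (forall i, finitely_generated (P i)) -> (forall i, projective (P i)) ->
  (forall (g : {linear P (top - 1) -> R^o}) u, m (g (cx_diff P top (top - 1) u))) ->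
  forall u, maximal_multiple m (cx_diff P top (top - 1) u).
Proof.
move=> fgP projP mind u; have [n [f [e fE]]] := dual_basis (fgP (top - 1)) (projP (top - 1)).
rewrite [cx_diff _ _ _ _]fE; elim/big_ind: _ => [|x y|k _].
- exact: submodule0 (maximal_multiple_submodule m _).
- exact: submoduleD (maximal_multiple_submodule m _).
exact/maximal_multipleZ/mind.
Qed.

Lemma minimal_not_extends N P top :
  finitely_generated N -> nonzero N ->
  (forall i, finitely_generated (P i)) -> (forall i, projective (P i)) ->
  nonzero (P top) ->
  (forall (g : {linear P (top - 1) -> R^o}) u, m (g (cx_diff P top (top - 1) u))) ->
  ~ extends N (cx_diff P top (top - 1)).
Proof.
move=> fgN N0 fgP projP Ptop0 mind ext.
have [u nu] := exists_not_maximal_multiple noethR localR (fgP top) Ptop0.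
have [f fu] := dual_unit (fgP top) (projP top) nu.
have [v nv] := exists_not_maximal_multiple noethR localR fgN N0.
have [g gE] := ext (scale_at v \o f).
have gv : g (cx_diff P top (top - 1) u) = v by rewrite gE /= /scale_at fu scale1r.
apply: nv; rewrite -gv.
exact/maximal_multiple_map/minimal_top_differential.
Qed.

End Minimality.

(** * Depth *)

Section DepthFormula.
Variables (R : comNzRingType) (m : set R).
Hypotheses (noethR : noetherian R) (localR : local_ring m).
Implicit Types (V W M N : lmodType R) (s t : seq R).

Notation mult V s := (genby s (@setT (GRing.Lmodule.sort V))).
Notation Ro := (R^o : lmodType R).

Lemma chain_maximal (Q : seq R -> Prop) s : Q s ->
  exists2 t, Q (t ++ s) & forall x, Q (x :: t ++ s) -> mult Ro (t ++ s) x.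
Proof.
move=> Qs; have [||_ [t Qt ->] tmax] := @maximal_ideal_family _ noethR
  [set I | exists2 t, Q (t ++ s) & I = mult Ro (t ++ s)].
- by move=> _ [t _ ->]; exact: (mult_submodule Ro).
- by exists (mult Ro s), [::].
exists t => // x Qx; apply: (tmax (mult Ro (x :: t ++ s))).
- by exists (x :: t).
- by move=> y; exact: (@sub_genby _ x (t ++ s) Ro setT (@submodule_setT _ Ro)).
rewrite -[x in mult _ _ x]mulr1.
exact: (@genby_head _ x _ Ro setT 1 (@submodule_setT _ Ro) I).
Qed.

Lemma regular_mod_projective V s x : finitely_generated V -> projective V ->
  regular_mod (mult Ro s) x -> regular_mod (mult V s) x.
Proof.
move=> fgV projV rx v sxv; have [n [f [e fE]]] := dual_basis fgV projV.
rewrite [v]fE; have sV := mult_submodule V s.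
elim/big_ind: _ => [|y z|k _]; [exact: submodule0|exact: submoduleD|].
apply: (@genby_map _ s Ro V setT setT (scale_at (e k))) => //; apply: rx.
by rewrite -linearZZ; exact: (@genby_map _ s V Ro setT setT (f k)).
Qed.

Lemma mult_ffun n M s (v : {ffun 'I_n -> M}) :
  mult {ffun 'I_n -> M} s v <-> forall k, mult M s (v k).
Proof.
have pr_lin k : linear (fun c : {ffun 'I_n -> M} => c k).
  by move=> a x y; rewrite !ffunE.
pose pr k : {linear {ffun 'I_n -> M} -> M} :=
  HB.pack (fun c : {ffun 'I_n -> M} => c k)
    (GRing.isLinear.Build _ _ _ _ (fun c : {ffun 'I_n -> M} => c k) (pr_lin k)).
pose inj k (x : M) : {ffun 'I_n -> M} := [ffun j => if j == k then x else 0].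
have inj_lin k : linear (inj k).
  by move=> a x y; apply/ffunP => j; rewrite !ffunE; case: eqP; rewrite // scaler0 addr0.
pose injL k : {linear M -> {ffun 'I_n -> M}} :=
  HB.pack (inj k) (GRing.isLinear.Build _ _ _ _ (inj k) (inj_lin k)).
split=> [sv k|sv]; first exact: (@genby_map _ s _ _ setT setT (pr k)).
have -> : v = \sum_k injL k (v k).
  apply/ffunP => j; rewrite sum_ffunE (bigD1 j) //= ffunE eqxx big1 ?addr0 // => k kj.
  by rewrite ffunE eq_sym (negPf kj).
have sV := mult_submodule {ffun 'I_n -> M} s.
elim/big_ind: _ => [|y z|k _]; [exact: submodule0|exact: submoduleD|].
exact: (@genby_map _ s _ _ setT setT (injL k)).
Qed.

Section Resolution.
Variables (M : lmodType R) (P : complex R) (a : int -> nat) (top h : int).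
Hypothesis rdP : resolution_data M P a top h.
Notation d := (cx_diff P).
Notation cycles k l := [set z | d k l z = 0].

Lemma homology_mult W s i k l (e : {linear kernel (d k l) -> W}) :
  (forall w, exists z, e z = w) ->
  (forall z, e z = 0 <-> exists y, d i k y = kernel_incl _ z) ->
  forall z, mult W s (e z) <->
    exists y, genby s (cycles k l) (kernel_incl _ z - d i k y).
Proof.
move=> surje kere z; split=> [sez|[y sy]].
  have [z' sz' ez'] : exists2 z', genby s (@setT (kernel (d k l))) z' & e z' = e z.
    by apply: genby_lift sez => w _; have [z' <-] := surje w; exists z'.
  have /kere[y yE] : e (z - z') = 0 by rewrite linearB ez' subrr.
  exists y; rewrite yE (linearB (kernel_incl (d k l))) opprB addrC subrK.
  apply: (genby_map (f := kernel_incl (d k l))) sz' => z'' _.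
  by apply/(kernel_inclP (d k l)); exists z''.
have [z' sz' zE] : exists2 z', genby s (@setT (kernel (d k l))) z' &
    kernel_incl _ z' = kernel_incl _ z - d i k y.
  by apply: genby_lift sy => c /kernel_inclP[z' <-]; exists z'.
have /kere : exists y', d i k y' = kernel_incl _ (z - z').
  by exists y; rewrite linearB zE opprB addrC subrK.
move/eqP; rewrite linearB subr_eq0 => /eqP ->.
exact: (genby_map (f := e)) sz'.
Qed.

Lemma genby_cycles s k l z : genby s (cycles k l) z -> mult (P k) s z.
Proof. by apply: (genby_map (f := idfun)). Qed.

Lemma mult_diff s i k z : mult (P i) s z -> mult (P k) s (d i k z).
Proof. exact: (genby_map (f := d i k)). Qed.

Lemma homology_regular s x i k l z : i = k + 1 -> l = k - 1 ->
  regular_mod (mult M s) x -> d k l z = 0 ->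
  (exists y, genby s (cycles k l) (x *: z - d i k y)) ->
  exists y, genby s (cycles k l) (z - d i k y).
Proof.
move=> ik lk rx /kernel_inclP[c <-].
have /(has_homologyP _ _ ik lk)[e [surje kere]] := rd_homology rdP k.
rewrite -linearZ => /(homology_mult s surje kere) sxc.
apply/(homology_mult s surje kere)/mult_ffun => j; apply: rx.
by move/mult_ffun: sxc => /(_ j); rewrite linearZ /= ffunE.
Qed.

(* In other words, H_k(P/sP) = H_k(P)/sH_k(P). *)
Lemma homology_reduction s :
  regular_chain m Ro s -> regular_chain m M s ->
  forall i k l, i = k + 1 -> l = k - 1 ->
  (forall z, mult (P l) s (d k l z) ->
     exists2 z', d k l z' = 0 & mult (P k) s (z - z')) /\
  (forall z, d k l z = 0 -> (exists y, mult (P k) s (z - d i k y)) ->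
     exists y, genby s (cycles k l) (z - d i k y)).
Proof.
elim: s => [_ _ i k l ik lk|x s IHs [mx rxR csR] [_ rxM csM] i k l ik lk].
  split=> [z /= dz|z dz [y zy]]; last by exists y.
  by exists z; rewrite ?subrr.
have {}IHs := IHs csR csM; have [IH1 IH2] := IHs i k l ik lk.
have rxP j : regular_mod (mult (P j) s) x.
  by apply: regular_mod_projective => //; [exact: rd_fg rdP _|exact: rd_projective rdP _].
have sP j := mult_submodule (P j) s.
split=> [z [w _ dzw]|z dz [y [w _ zyw]]].
  have kl : k = l + 1 by rewrite lk subrK.
  have [IH1l IH2l] := IHs k l (l - 1) kl erefl.
  have [w' dw' sww'] : exists2 w', d l (l - 1) w' = 0 & mult (P l) s (w - w').
    apply: IH1l; apply: rxP; rewrite -linearZ.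
    have := mult_diff (l - 1) dzw; rewrite linearB cx_diff_diff sub0r.
    by move/(submoduleN (sP _)); rewrite opprK.
  have [y sy] : exists y, genby s (cycles l (l - 1)) (w' - d k l y).
    apply: (@homology_regular s x) => //; apply: IH2l.
      by rewrite linearZ /= dw' scaler0.
    exists z; have -> : x *: w' - d k l z = - (d k l z - x *: w) - x *: (w - w').
      by zmod_solve.
    by apply: submoduleB => //; [exact: submoduleN|exact: submoduleZ].
  have [z' dz' szz'] : exists2 z', d k l z' = 0 & mult (P k) s (z - x *: y - z').
    apply: IH1; rewrite linearB linearZ /=.
    have -> : d k l z - x *: d k l y =
        (d k l z - x *: w) + x *: ((w - w') + (w' - d k l y)) by zmod_solve.
    apply: submoduleD => //; apply: submoduleZ => //; apply: submoduleD => //.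
    exact: genby_cycles sy.
  by exists z' => //; exists y => //; rewrite addrAC.
have [w' dw' sww'] : exists2 w', d k l w' = 0 & mult (P k) s (w - w').
  apply: IH1; apply: rxP; rewrite -linearZ.
  have := mult_diff l zyw; rewrite !linearB cx_diff_diff dz subr0 sub0r.
  by move/(submoduleN (sP _)); rewrite opprK.
have [||y' sy'] := IH2 (z - x *: w').
- by rewrite linearB linearZ /= dz dw' scaler0 subr0.
- exists y; have -> : z - x *: w' - d i k y = (z - d i k y - x *: w) + x *: (w - w').
    by zmod_solve.
  by apply: submoduleD => //; exact: submoduleZ.
by exists y'; exists w' => //; rewrite addrAC.
Qed.

Definition acyclic_above s (b : int) : Prop := forall i k l,
  i = k + 1 -> l = k - 1 -> b < k -> forall z, mult (P l) s (d k l z) ->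
  exists y, mult (P k) s (z - d i k y).

Definition socle_cycle s i k l : Prop := exists z, [/\ mult (P l) s (d k l z),
  ~ (exists y, mult (P k) s (z - d i k y)) &
  forall c, m c -> exists y, mult (P k) s (c *: z - d i k y)].

Lemma acyclic_above_cons s x b : regular_mod (mult Ro s) x ->
  acyclic_above s b -> acyclic_above (x :: s) (b + 1).
Proof.
move=> rxR acs i k l ik lk bk z [w _ dzw].
have rxP j : regular_mod (mult (P j) s) x.
  by apply: regular_mod_projective => //; [exact: rd_fg rdP _|exact: rd_projective rdP _].
have sP j := mult_submodule (P j) s.
have [y sy] : exists y, mult (P l) s (w - d k l y).
  apply: (acs k l (l - 1)) => //; first by rewrite lk subrK.
    by rewrite lk ltrBrDr.
  apply: rxP; rewrite -linearZ.
  have := mult_diff (l - 1) dzw; rewrite linearB cx_diff_diff sub0r.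
  by move/(submoduleN (sP _)); rewrite opprK.
have [||y' sy'] := acs i k l ik lk _ (z - x *: y).
- by apply: lt_trans bk; rewrite ltrDl.
- rewrite linearB linearZ /=.
  have -> : d k l z - x *: d k l y = (d k l z - x *: w) + x *: (w - d k l y).
    by zmod_solve.
  by apply: submoduleD => //; exact: submoduleZ.
by exists y'; exists y => //; rewrite addrAC.
Qed.

Lemma socle_cycle_cons s x i k l : i = k + 1 -> l = k - 1 ->
  m x -> regular_mod (mult Ro s) x -> acyclic_above s k ->
  socle_cycle s i k l -> socle_cycle (x :: s) (i + 1) i k.
Proof.
move=> ik lk mx rxR acs [z [dz nz mz]].
have rxP j : regular_mod (mult (P j) s) x.
  by apply: regular_mod_projective => //; [exact: rd_fg rdP _|exact: rd_projective rdP _].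
have sP j := mult_submodule (P j) s.
have [w xzw] := mz x mx; exists w; split=> [|[v [v' _ wvv']]|c mc].
- by exists z => //; rewrite -opprB; exact: submoduleN.
- apply: nz; exists v'; apply: rxP.
  have -> : x *: (z - d i k v') = (x *: z - d i k w) + d i k (w - d (i + 1) i v - x *: v').
    have -> : d i k (w - d (i + 1) i v - x *: v') = d i k w - x *: d i k v'.
      by rewrite linearB linearB cx_diff_diff subr0 linearZ.
    by zmod_solve.
  by apply: submoduleD => //; exact: mult_diff.
have [u czu] := mz c mc.
have [|||y sy] := acs (i + 1) i k erefl _ _ (c *: w - x *: u).
- by rewrite ik addrK.
- by rewrite ik ltrDl.
- have -> : d i k (c *: w - x *: u) =
      x *: (c *: z - d i k u) - c *: (x *: z - d i k w).
    by rewrite linearB !linearZ /= !scalerBr !scalerA [x * c]mulrC; zmod_solve.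
  by apply: submoduleB => //; exact: submoduleZ.
by exists y; exists u => //; rewrite addrAC.
Qed.

Hypothesis dtop : forall u, maximal_multiple m (d top (top - 1) u).
Hypothesis Ptop0 : nonzero (P top).

Lemma top_socle s : has_socle m (mult Ro s) ->
  exists z : P top, [/\ ~ mult (P top) s z, mult (P (top - 1)) s (d top (top - 1) z) &
    forall c, m c -> mult (P top) s (c *: z)].
Proof.
move=> [x nx mx].
have [u nu] := exists_not_maximal_multiple noethR localR (rd_fg rdP top) Ptop0.
have [f fu] := dual_unit noethR localR (rd_fg rdP top) (@rd_projective _ _ _ _ _ _ rdP top) nu.
have scaleP j (v : P j) c : m c -> mult (P j) s ((c * x) *: v).
  by move=> mc; apply: (@genby_map _ s Ro (P j) setT setT (scale_at v)) => //; exact: mx.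
exists (x *: u); split=> [sxu|//|c mc]; last by rewrite scalerA; exact: scaleP.
  apply: nx; have := @genby_map _ s (P top) Ro setT setT f (fun _ _ => I) _ sxu.
  by rewrite linearZ /= fu [_ *: _]mulr1.
rewrite linearZ /=; have [t tm] := dtop u.
have sP := mult_submodule (P (top - 1)) s.
apply: (@genby_min _ t _ setT [set y | mult (P (top - 1)) s (x *: y)]).
  split=> [|c y z sy sz] /=; first by rewrite scaler0; exact: submodule0.
  rewrite scalerDr scalerA mulrC -scalerA.
  by apply: submoduleD => //; exact: submoduleZ.
by move=> c v /tm mc _ /=; rewrite scalerA mulrC; exact: scaleP.
Qed.

Lemma boundary_top y : d (top + 1) top y = 0.
Proof.
rewrite (_ : y = 0) ?linear0 //; apply: zero_eq.
by apply: (rd_top rdP); rewrite ltrDl.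
Qed.

Lemma socle_ring_module s : regular_chain m Ro s -> regular_chain m M s ->
  has_socle m (mult Ro s) -> has_socle m (mult M s).
Proof.
move=> csR csM /top_socle[z [nz dz mz]].
have [red1 red2] := homology_reduction csR csM (erefl (top + 1)) (erefl (top - 1)).
have /(has_homologyP (k := top) _ _ erefl erefl)[e [surje kere]] := rd_homology rdP top.
have [z' /kernel_inclP[c <-] zc] := red1 _ dz.
have hm := homology_mult s surje kere; have sP := mult_submodule (P top) s.
have [j nj] : exists j, ~ mult M s (e c j).
  apply: contrapT => no; apply: nz.
  have /hm[y] : mult {ffun 'I_(a top) -> M} s (e c).
    by apply/mult_ffun => j; apply: contrapT => nj; apply: no; exists j.
  rewrite boundary_top subr0 => /genby_cycles sc.
  exact: submoduleBl sc zc.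
exists (e c j) => // b mb.
have : mult {ffun 'I_(a top) -> M} s (e (b *: c)).
  apply/hm/red2; first by apply/kernel_inclP; exists (b *: c).
  exists 0; rewrite linear0 subr0 linearZ /=.
  have -> : b *: kernel_incl (d top (top - 1)) c =
      b *: z - b *: (z - kernel_incl (d top (top - 1)) c) by zmod_solve.
  by apply: submoduleB => //; [exact: mz|exact: submoduleZ].
by move/mult_ffun/(_ j); rewrite linearZ /= ffunE.
Qed.

Lemma acyclic_above_hsup s : regular_chain m Ro s -> regular_chain m M s ->
  acyclic_above s h.
Proof.
move=> csR csM i k l ik lk hk z dz.
have [red1 _] := homology_reduction csR csM ik lk.
have /(has_homologyP _ _ ik lk)[e [_ kere]] := rd_homology rdP k.
have [z' /kernel_inclP[c <-] zc] := red1 _ dz.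
have /kere[y yE] : e c = 0.
  by move: (e c); rewrite (rd_hsup_max rdP hk); exact: zero_eq (@zero_module_ffun _ M).
by exists y; rewrite yE.
Qed.

Lemma socle_cycle_hsup s : regular_chain m Ro s -> regular_chain m M s ->
  has_socle m (mult M s) -> socle_cycle s (h + 1) h (h - 1).
Proof.
move=> csR csM [v nv mv].
have [_ red2] := homology_reduction csR csM (erefl (h + 1)) (erefl (h - 1)).
have /(has_homologyP (k := h) _ _ erefl erefl)[e [surje kere]] := rd_homology rdP h.
have hm := homology_mult s surje kere.
have [c cE] := surje [ffun=> v].
have dc : d h (h - 1) (kernel_incl _ c) = 0 by apply/kernel_inclP; exists c.
exists (kernel_incl _ c); split=> [|[y sy]|b mb].
- by rewrite dc; exact: submodule0 (mult_submodule _ _).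
- have /hm/mult_ffun : exists y, genby s (cycles h (h - 1)) (kernel_incl _ c - d (h + 1) h y).
    by apply: red2 => //; exists y.
  have j : 'I_(a h) by case: (a h) (rd_hsup rdP) => // n _; exact: ord0.
  by move/(_ j); rewrite cE ffunE.
have /hm[y] : mult {ffun 'I_(a h) -> M} s (e (b *: c)).
  by apply/mult_ffun => j; rewrite linearZ /= cE !ffunE; exact: mv.
by rewrite linearZ => /genby_cycles sy; exists y.
Qed.

Lemma regular_chain_top s t : regular_chain m Ro (t ++ s) -> regular_chain m M s ->
  has_socle m (mult M s) -> has_socle m (mult Ro (t ++ s)) -> top = h + (size t)%:Z.
Proof.
move=> csR csM socM socR.
have [acs [i [l [ei el scs]]]] : acyclic_above (t ++ s) (h + (size t)%:Z) /\
    exists i l, [/\ i = h + (size t)%:Z + 1, l = h + (size t)%:Z - 1 &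
      socle_cycle (t ++ s) i (h + (size t)%:Z) l].
  elim: t csR {socR} => [csR|x t IHt [mx rx csR]].
    rewrite addr0; split; first exact: acyclic_above_hsup.
    by exists (h + 1), (h - 1); split=> //; exact: socle_cycle_hsup.
  have [acs [i [l [ei el scs]]]] := IHt csR.
  have eS : h + (size (x :: t))%:Z = h + (size t)%:Z + 1.
    by rewrite /= -addn1 PoszD addrA.
  rewrite eS; split; first exact: acyclic_above_cons.
  exists (i + 1), (h + (size t)%:Z); split; [by rewrite ei|by rewrite addrK|].
  by rewrite -ei; apply: socle_cycle_cons scs.
apply/eqP; rewrite eq_le; apply/andP; split.
  rewrite leNgt; apply/negP => lt_top; have [z [nz dz _]] := top_socle socR.
  have [y] := acs _ _ _ erefl erefl lt_top z dz.
  by rewrite boundary_top subr0.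
rewrite leNgt; apply/negP => /(rd_top rdP) P0.
have [z [_ nz _]] := scs; apply: nz; exists 0.
by rewrite (zero_eq P0 z) linear0 subr0; exact: submodule0 (mult_submodule _ _).
Qed.

Lemma depth_formula : finitely_generated M -> nonzero M ->
  exists n l, [/\ top - h = l%:Z, depth m M = n%:Z%:E & depth m Ro = (l + n)%:Z%:E].
Proof.
move=> fgM M0; have fgR := fg_ring R.
have [t [csR csM] tmax] := @chain_maximal
  (fun s => regular_chain m Ro s /\ regular_chain m M s) [::] (conj I I).
rewrite cats0 in csR csM tmax.
have idm := local_ideal localR.
have R0 : nonzero Ro by exists (1 : R); exact: oner_neq0.
have socM : has_socle m (mult M t).
  have [socR|nsocR] := pselect (has_socle m (mult Ro t)); first exact: socle_ring_module.
  apply: contrapT => nsocM.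
  have [x mx] : exists2 x, m x & regular_mod (mult Ro t `*` mult M t) x.
    apply: prime_avoidance => //; first exact: fg_prod.
      by apply: submoduleX; exact: mult_submodule.
    by case/has_socleX.
  case/regular_modX; [exact: mult_submodule|exact: mult_submodule|move=> rxR rxM].
  apply: (regular_not_mem noethR localR fgM M0 _ rxM); first exact: regular_chain_mem csR.
  exact: tmax.
have [t' csR' t'max] := @chain_maximal (regular_chain m Ro) t csR.
have socR : has_socle m (mult Ro (t' ++ t)).
  apply: contrapT => nsocR.
  have [x mx rx] := prime_avoidance noethR idm fgR (mult_submodule Ro (t' ++ t)) nsocR.
  apply: (regular_not_mem noethR localR fgR R0 _ rx); first exact: regular_chain_mem csR'.
  exact: t'max.
exists (size t), (size t'); split.
- by rewrite (regular_chain_top csR' csM socM socR) addrAC subrr add0r.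
- apply: depthE => //; have := @maximal_regular_cat _ m M 0 t [::].
  by rewrite cats0 add0n; apply.
apply: depthE => //; have := @maximal_regular_cat _ m Ro 0 (t' ++ t) [::].
by rewrite cats0 add0n size_cat; apply.
Qed.

End Resolution.
End DepthFormula.

(** * Quasi-projective dimension *)

Section ExtendedIntegers.
Implicit Types A : set int.

Lemma eint_sup_int A : A !=set0 ->
  (exists2 n, A n & (forall i, A i -> i <= n) /\
     eint_sup [set i%:E | i in A] = n%:E%E) \/
  eint_sup [set i%:E | i in A] = +oo%E /\ ~ exists u, forall i, A i -> i <= u.
Proof.
move=> [i0 Ai0]; have [[u Au]|nu] := pselect (exists u, forall i, A i -> i <= u).
  left; have [|n An nmin] := @minimum_nat (fun n => A (u - n%:Z)).
    exists `|u - i0|%N; rewrite gez0_abs ?subr_ge0; last exact: Au.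
    by rewrite subKr.
  have nmax i : A i -> i <= u - n%:Z.
    move=> Ai; have := Au i Ai => iu.
    have : (n <= `|u - i|)%N.
      apply: nmin; rewrite gez0_abs ?subr_ge0 //.
      by rewrite subKr.
    lia.
  exists (u - n%:Z) => //; split=> //; apply: eint_sup_max; first by exists (u - n%:Z).
  by move=> _ [i Ai <-]; rewrite lee_fin; exact: nmax.
right; split=> //; set S := (X in eint_sup X).
have supS : supremums S +oo%E.
  split=> [x _|y ubS]; first exact: leey.
  case: y ubS => [r|//|] ubS.
    exfalso; apply: nu; exists r => i Ai; rewrite -lee_fin; apply: ubS.
    by exists i.
  by have /ubS : S i0%:E by exists i0.
rewrite /eint_sup /supremum ifF; last by apply/negbTE/set0P; exists i0%:E, i0.
by apply: xget_subset1 supS _; exact: is_subset1_supremums.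
Qed.

Lemma eint_inf_int A : A !=set0 ->
  (exists2 n, A n & (forall i, A i -> n <= i) /\
     eint_inf [set i%:E | i in A] = n%:E%E) \/
  eint_inf [set i%:E | i in A] = -oo%E /\ ~ exists u, forall i, A i -> u <= i.
Proof.
move=> [i0 Ai0]; have [[u Au]|nu] := pselect (exists u, forall i, A i -> u <= i).
  left; have [|n An nmin] := @minimum_nat (fun n => A (u + n%:Z)).
    exists `|i0 - u|%N; rewrite gez0_abs ?subr_ge0; last exact: Au.
    by rewrite addrCA subrr addr0.
  have nmax i : A i -> u + n%:Z <= i.
    move=> Ai; have := Au i Ai => iu.
    have : (n <= `|i - u|)%N.
      by apply: nmin; rewrite gez0_abs ?subr_ge0 // addrCA subrr addr0.
    lia.
  exists (u + n%:Z) => //; split=> //; apply: eint_inf_min; first by exists (u + n%:Z).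
  by move=> _ [i Ai <-]; rewrite lee_fin; exact: nmax.
right; split=> //; set S := (X in eint_inf X).
have infS : infimums S -oo%E.
  split=> [x _|y lbS]; first exact: leNye.
  case: y lbS => [r| |//] lbS.
    exfalso; apply: nu; exists r => i Ai; rewrite -lee_fin; apply: lbS.
    by exists i.
  by have /lbS : S i0%:E by exists i0.
rewrite /eint_inf /infimum ifF; last by apply/negbTE/set0P; exists i0%:E, i0.
by apply: xget_subset1 infS _; exact: is_subset1_infimums.
Qed.

End ExtendedIntegers.

Section QuasiProjectiveDimension.
Variable R : comNzRingType.
Implicit Types (M V W : lmodType R) (P : complex R).

Lemma isomorphic_nonzero V W : isomorphic V W -> nonzero V <-> nonzero W.
Proof.
move=> [f [g fK gK]]; split=> [[x nx]|[y ny]].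
  by exists (f x); apply: contra nx => /eqP fx; rewrite -[x]fK -[0]fK linear0 fx.
by exists (g y); apply: contra ny => /eqP gy; rewrite -[y]gK gy linear0.
Qed.

Lemma isomorphic_zero V W : ~ nonzero V -> ~ nonzero W -> isomorphic V W.
Proof.
move=> V0 W0; exists \0; exists (fun=> 0) => x /=.
  by rewrite (zero_eq V0 x).
by rewrite (zero_eq W0 x).
Qed.

Lemma homology_nonzero P i : nonzero (Hlgy P i) -> nonzero (P i).
Proof.
move=> H; apply: contrapT => P0; move: H; apply/homology_zero => z _; exists 0.
by rewrite linear0 (zero_eq P0 z).
Qed.

Lemma ffun_nonzero M n : nonzero M -> nonzero {ffun 'I_n -> M} <-> n != 0%N.
Proof.
move=> [x nx]; case: n => [|n].
  by split=> // nz; case: (@zero_module_ffun R M nz).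
split=> // _; exists [ffun=> x]; apply: contra nx => /eqP/ffunP/(_ ord0).
by rewrite !ffunE => ->.
Qed.

Lemma quasi_projective_resolution_data M P : nonzero M ->
  quasi_projective_resolution M P -> bounded P ->
  exists a top h, [/\ resolution_data M P a top h,
    csup P = top%:E%E & hsup P = h%:E%E].
Proof.
move=> M0 [bb fgproj [a0 [[i0 [i0P a0i0]] iso0]]] bP.
have Pi0 : nonzero (P i0).
  apply: homology_nonzero; apply/(isomorphic_nonzero (iso0 i0 i0P)).
  by apply/ffun_nonzero => //; exact/eqP.
have [[l Pl [lmin El]]|[El _]] :=
  @eint_inf_int [set i | nonzero (P i)] (ex_intro _ i0 Pi0); last first.
  by move: bb; rewrite /bounded_below /cinf El ltxx.
have {}El : cinf P = l%:E%E := El.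
have [[top Ptop [topmax Etop]]|[Etop _]] :=
  @eint_sup_int [set i | nonzero (P i)] (ex_intro _ i0 Pi0); last first.
  by move: bP; rewrite /bounded /csup Etop El.
pose a i := if l <= i then a0 i else 0%N.
have isoa i : isomorphic (Hlgy P i) {ffun 'I_(a i) -> M}.
  rewrite /a; case: ifP => li; first by apply: iso0; rewrite El lee_fin.
  apply: isomorphic_zero; last exact: zero_module_ffun.
  by move/homology_nonzero/lmin; rewrite li.
have aH i : nonzero (Hlgy P i) <-> a i != 0%N.
  exact: iff_trans (isomorphic_nonzero (isoa i)) (ffun_nonzero _ M0).
have li0 : l <= i0 by apply: lmin.
have Hi0 : nonzero (Hlgy P i0) by apply/aH; rewrite /a li0; exact/eqP.
have [[h Hh [hmax Eh]]|[_ nb]] :=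
  @eint_sup_int [set i | nonzero (Hlgy P i)] (ex_intro _ i0 Hi0); last first.
  by case: nb; exists top => i /homology_nonzero/topmax.
exists a, top, h; split=> //; split=> //.
- by move=> i; case: (fgproj i).
- by move=> i; case: (fgproj i).
- by exists l => i il /lmin; rewrite leNgt il.
- exact/aH.
- move=> i hi; apply/eqP; apply: contraT => /aH/hmax.
  by rewrite leNgt hi.
- by move=> i topi /topmax; rewrite leNgt topi.
Qed.

Lemma resolution_data_quasi_projective M P a top h : nonzero M ->
  resolution_data M P a top h -> nonzero (P top) ->
  [/\ quasi_projective_resolution M P, bounded P,
      csup P = top%:E%E & hsup P = h%:E%E].
Proof.
move=> M0 rdP Ptop.
have Etop : csup P = top%:E%E.
  apply: eint_sup_max; first by exists top.
  move=> _ [i Pi <-]; rewrite lee_fin leNgt; apply/negP => /(rd_top rdP).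
  exact.
have aH i : nonzero (Hlgy P i) <-> a i != 0%N.
  exact: iff_trans (isomorphic_nonzero (rd_homology rdP i)) (ffun_nonzero _ M0).
have Eh : hsup P = h%:E%E.
  apply: eint_sup_max; first by exists h => //; apply/aH; exact: rd_hsup rdP.
  move=> _ [i /aH ai <-]; rewrite lee_fin leNgt; apply/negP => /(rd_hsup_max rdP) ai0.
  by rewrite ai0 in ai.
have [l lP] := rd_low rdP.
have [[k Pk [kmin Ek]]|[_ nb]] :=
  @eint_inf_int [set i | nonzero (P i)] (ex_intro _ top Ptop); last first.
  by case: nb; exists l => i Pi; rewrite leNgt; apply/negP => /lP; exact.
have {}Ek : cinf P = k%:E%E := Ek.
split=> //; last by rewrite /bounded Etop Ek -EFinB ltry.
split.
- by rewrite /bounded_below Ek ltNyr.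
- by move=> i; split; [exact: rd_fg rdP _|exact: (@rd_projective _ _ _ _ _ _ rdP i)].
exists a; split=> [|i _]; last exact: rd_homology rdP i.
exists h; rewrite Ek; split; last exact/eqP/(rd_hsup rdP).
rewrite lee_fin; apply: kmin; exact: resolution_hsup_nonzero rdP.
Qed.

End QuasiProjectiveDimension.

Local Open Scope ring_scope.
Local Open Scope ereal_scope.

Theorem theorem3p2 (R : comNzRingType) (m : set R)
    (noethR : noetherian R) (localR : local_ring m)
    (M N : lmodType R)
    (fgM : finitely_generated M) (fgN : finitely_generated N)
    (M0 : nonzero M) (N0 : nonzero N)
    (PMN : PExt M N < +oo) (qM : qpd M < +oo) :
  PExt M N = qpd M /\ qpd M = depth m R^o - depth m M.
Proof.
have [P0 [qpP0 bP0 _]] : exists P, [/\ quasi_projective_resolution M P, bounded P & True].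
  apply: contrapT => no; move: qM; rewrite /qpd; set A := [set _ | _].
  suff -> : A = set0 by rewrite /eint_inf /infimum eqxx ltxx.
  by apply/seteqP; split=> // d [P [qpP bP _]]; apply: no; exists P.
have [a0 [top0 [h0 [rd0 _ _]]]] := quasi_projective_resolution_data M0 qpP0 bP0.
have [|P [a [top [h [rdP Pmin Ptop mind]]]]] := resolution_minimal noethR localR M0.
  by exists P0, a0, top0, h0.
have [qpP bP csP hsP] := resolution_data_quasi_projective M0 rdP Ptop.
have qpdE : qpd M = (top - h)%R%:E.
  apply: eint_inf_min; first by exists P; split=> //; rewrite csP hsP EFinB.
  move=> _ [P' [qpP' bP' ->]].
  have [a' [top' [h' [rdP' -> ->]]]] := quasi_projective_resolution_data M0 qpP' bP'.
  by rewrite -EFinB lee_fin; exact: Pmin rdP'.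
have dtop := minimal_top_differential (rd_fg rdP) (@rd_projective _ _ _ _ _ _ rdP) mind.
have nonext := minimal_not_extends noethR localR fgN N0 (rd_fg rdP)
  (@rd_projective _ _ _ _ _ _ rdP) Ptop mind.
have [n [l [toph depthM depthR]]] := depth_formula noethR localR rdP dtop Ptop fgM M0.
split; last by rewrite qpdE toph depthM depthR -EFinB PoszD addrK.
rewrite qpdE toph.
have etop : top = (h + l%:Z)%R by rewrite -toph addrCA subrr addr0.
have [q vq] : exists q, forall j, (q <= j)%N -> ext_vanishes N j M.
  have [[i0 Ei0]|noE] := pselect (exists i, nonzero (Ext i M N)); last first.
    by exists 0%N => j _; apply/ExtS_vanishes => E; apply: noE; exists j.+1.
  have [|[_ [k Ek <-] [kmax _]]|[Ek _]] :=
    @eint_sup_int [set i%:Z | i in [set i | nonzero (Ext i M N)]].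
  - by exists i0%:Z, i0.
  - exists k => j kj; apply/ExtS_vanishes => Ej.
    have : (j.+1%:Z <= k%:Z)%R by apply: kmax; exists j.+1.
    by rewrite lez_nat ltnNge kj.
  - have PE : PExt M N = +oo by rewrite -Ek image_comp.
    by move: PMN; rewrite PE ltxx.
have vl j : (l <= j)%N -> ext_vanishes N j M.
  have [k] := ubnP (q - j)%N; elim: k j => // k IHk j qjk lj.
  have [qj|jq] := leqP q j; first exact: vq.
  apply: (ext_vanishes_below rdP etop lj) => j' jj'; apply: IHk; last first.
    exact: leq_trans lj (ltnW jj').
  lia.
apply: eint_sup_max.
  exists l => //=; apply: contrapT => El; apply: nonext.
  case: l etop vl El {toph depthR} => [|l] etop vl El.
    apply: (extends_top_hsup rdP); first by rewrite etop addr0.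
      by move=> j; exact: vl.
    exact: Ext0_vanishes.
  apply: (extends_top rdP etop (leqnn l)) => j.
  rewrite leq_eqVlt => /predU1P[<-|/vl//].
  exact/ExtS_vanishes.
move=> _ [[|i] /= Ei <-]; rewrite lee_fin ?lez_nat // leqNgt.
by apply/negP => li; move: Ei; apply/ExtS_vanishes; exact: vl.
Qed.
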